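(* Let $A=\sum_{i=0}^p\lambda_iP_i$ be an observable on $\mathcal{H}=\mathbb{C}^{N+1}$ with $p^0_{00}\neq0$ (which can be assumed up to permutation of the eigenprojectors). Define $I=\{i\in\{1,\dots,p\}:p^i_{00}=0\}$ and $J=\{1,\dots,p\}\setminus I$. Let $\mathcal{A}_n^J$ be the Markov generator of the discrete quantum trajectory $(\rho^J_n(t))$ obtained from the measurement of $A$ (defined in the context). 1. If $I=\{1,\dots,p\}$, then $p^0_{00}=1$ and $J=\emptyset$, and for all $f\in C^2_c(E)$, $$\lim_{n\to\infty}\sup_{\rho\in\mathcal{S}}\big|\mathcal{A}^J_nf(\rho)-\mathcal{A}^Jf(\rho)\big|=0,$$ where $$\mathcal{A}^Jf(\rho)=D_\rho f(L(\rho))+\int_E\big[f(\rho+\mu)-f(\rho)-D_\rho f(\mu)\big]\Pi(\rho,d\mu),\qquad \Pi(\rho,d\mu)=\sum_{i=1}^pv_i(\rho)\delta_{g_i(\rho)}(d\mu).$$ 2. If $I\neq\{1,\dots,p\}$, then $p^0_{00}\neq1$ and $J\ne\emptyset$, and for all $f\in C^2_c(E)$, $$\lim_{n\to\infty}\sup_{\rho\in\mathcal{S}}\big|\mathcal{A}^J_nf(\rho)-\mathcal{A}^Jf(\rho)\big|=0,$$ where $$\mathcal{A}^Jf(\rho)=D_\rho f(L(\rho))+\frac12\sum_{i\in J\cup\{0\}}D^2_\rho f(h_i(\rho),h_i(\rho))+\int_E\big[f(\rho+\mu)-f(\rho)-D_\rho f(\mu)\big]\Pi(\rho,d\mu),\qquad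 \Pi(\rho,d\mu)=\sum_{i\in I}v_i(\rho)\delta_{g_i(\rho)}(d\mu).$$
   Context: **Spaces.** $\mathcal{H}_0=\mathbb{C}^{K+1}$; $\mathcal{H}=\mathbb{C}^{N+1}$ with orthonormal basis $(X_0,\dots,X_N)$. A state is a positive operator with trace $1$; $\mathcal{S}$ is the (compact) set of states on $\mathcal{H}_0$. $E\cong\mathbb{R}^P$, $P=2(K+1)^2$, is the real vector space of all operators on $\mathcal{H}_0$; $C_c^2(E)$ is the set of real $C^2$ functions with compact support; $D_\rho f$, $D^2_\rho f$ are the first and second differentials of $f$ at $\rho$. Operators on $\mathcal{H}_0\otimes\mathcal{H}$ are written in blocks $M=(M_{kl})_{0\le k,l\le N}=\sum_{k,l}M_{kl}\otimes|X_k\rangle\langle X_l|$; $\mathbf{E}_0[M]=\sum_kM_{kk}$ is the partial trace over $\mathcal{H}$. Put $\beta=|X_0\rangle\langle X_0|$. **Interaction.** For each $n\ge1$, $U(n)=(U_{kl}(n))$ is a unitary operator on $\mathcal{H}_0\otimes\mathcal{H}$, and there are operators $L_{00},L_{10},\dots,L_{N0}$ on $\mathcal{H}_0$ with $n(U_{00}(n)-I)\to L_{00}$ and $\sqrt n\,U_{k0}(n)\to L_{k0}$ for $1\le k\le N$ as $n\to\infty$. **Observable.** $A=\sum_{i=0}^p\lambda_iP_i$ is the spectral decomposition of a self-adjoint operator on $\mathcal{H}$ (distinct real $\lambda_i$, orthogonal eigenprojectors $P_i$, $\sum_iP_i=I$), and $p^i_{kl}=\langle X_l,P_iX_k\rangle$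 (inner product linear in the second variable). **Generator of the discrete trajectory.** For $\rho\in\mathcal{S}$ let $p^i(\rho)=\mathrm{Tr}[U(n)(\rho\otimes\beta)U(n)^\star(I\otimes P_i)]$ and, if $p^i(\rho)\neq0$, $\mathcal{L}^{(n)}_i(\rho)=\mathbf{E}_0[(I\otimes P_i)U(n)(\rho\otimes\beta)U(n)^\star(I\otimes P_i)]/p^i(\rho)$. For fixed $n$, $(\rho_m)_{m\ge0}$ is the $\mathcal{S}$-valued Markov chain with transition kernel $\Pi_n(\rho,\cdot)=\sum_ip^i(\rho)\delta_{\mathcal{L}^{(n)}_i(\rho)}$, and $\rho_n^J(t)=\rho_{[nt]}$. Its Markov generator is $$\mathcal{A}^J_nf(\rho)=n\sum_{i=0}^p\big(f(\mathcal{L}^{(n)}_i(\rho))-f(\rho)\big)p^i(\rho),\quad \rho\in\mathcal{S},\ f\in C^2_c(E)$$ (terms with $p^i(\rho)=0$ are $0$). **Coefficients.** For $\rho\in\mathcal{S}$: $L(\rho)=L_{00}\rho+\rho L_{00}^\star+\sum_{1\le k\le N}L_{k0}\rho L_{k0}^\star$; $v_i(\rho)=\mathrm{Tr}[\sum_{1\le k,l\le N}p^i_{kl}L_{k0}\rho L_{l0}^\star]$; $g_i(\rho)=\frac{\sum_{1\le k,l\le N}p^i_{kl}L_{k0}\rho L_{l0}^\star}{v_i(\rho)}-\rho$ when $v_i(\rho)\neq0$ (when $v_i(\rho)=0$ the term $v_i(\rho)\delta_{g_i(\rho)}$ is $0$); for $p^i_{00}\neq0$, $h_i(\rho)=\frac1{\sqrt{p^i_{00}}}\big[\sum_{1\le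 k\le N}(p^i_{k0}L_{k0}\rho+p^i_{0k}\rho L_{k0}^\star)-\mathrm{Tr}[\sum_{1\le k\le N}(p^i_{k0}L_{k0}\rho+p^i_{0k}\rho L_{k0}^\star)]\rho\big]$. *)

(* Defs.v *)
(* MathComp world: MathComp-Analysis and MathComp-Real-closed (complex
   numbers R[i] over a realType, tensor product of matrices). *)
From HB Require Import structures.
From mathcomp Require Import all_boot all_order all_algebra.
From mathcomp Require Import complex.
From mathcomp Require mxtens.
From mathcomp Require Import all_classical all_reals all_analysis.

Set Implicit Arguments.
Unset Strict Implicit.
Unset Printing Implicit Defensive.

Import Order.TTheory GRing.Theory Num.Theory.
Import numFieldNormedType.Exports.

Local Open Scope classical_set_scope.
Local Open Scope sesquilinear_scope.
Local Open Scope ring_scope.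
Local Open Scope complex_scope.

Notation "A ⊗ B" := (mxtens.tensmx A B)
  (at level 40, left associativity) : ring_scope.

Section RealVectorSpaceOfOperators.
Variables (R : realType) (K : nat).

(* The real vector space E of all operators on C^(K+1), of real dimension
   2(K+1)^2: an operator is identified with the pair of its entrywise real and
   imaginary parts, so that the real normed structure of the library applies. *)
Definition opE : normedModType R := ('M[R]_K.+1 * 'M[R]_K.+1)%type.

Definition toE (M : 'M[R[i]]_K.+1) : opE :=
  (map_mx (@complex.Re R) M, map_mx (@complex.Im R) M).

Definition borelE := g_sigma_algebraType (@open opE).

Definition D1 (f : opE -> R) (x u : opE) : R := 'd f x u.

Definition D2 (f : opE -> R) (x u v : opE) : R :=
  'd (fun y => D1 f y v) x u.

(* Real C^2 functions with compact support. As E is finite-dimensional,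
   differentiability of y |-> D_y f into the dual of E amounts to that of
   y |-> D_y f(v) for every v, and likewise for the continuity of D^2 f. *)
Definition C2c (f : opE -> R) : Prop :=
  [/\ forall x, differentiable f x,
      forall v x, differentiable (fun y => D1 f y v) x,
      forall u v, continuous (fun x => D2 f x u v)
    & compact (closure [set x | f x != 0])].

End RealVectorSpaceOfOperators.

Section QuantumMechanics.
Variable R : realType.
Local Notation C := R[i].

Definition positive_op m (M : 'M[C]_m) : Prop :=
  forall u : 'cV[C]_m, 0 <= (u^t* *m M *m u) 0 0.

Definition states m : set 'M[C]_m :=
  [set rho | positive_op rho /\ \tr rho = 1].

Definition orthonormal_basis m (X : 'I_m -> 'cV[C]_m) : Prop :=
  forall k l, ((X k)^t* *m X l) 0 0 = (k == l)%:R.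

(* For k = l this is the projector |X_k><X_k|. *)
Definition ketbra m (X : 'I_m -> 'cV[C]_m) (k l : 'I_m) : 'M[C]_m :=
  X k *m (X l)^t*.

Definition spectral_decomposition m p (A : 'M[C]_m)
    (lambda : 'I_p.+1 -> R) (P : 'I_p.+1 -> 'M[C]_m) : Prop :=
  [/\ injective lambda,
      forall i, [/\ P i != 0, (P i)^t* = P i & P i *m P i = P i],
      forall i j, i != j -> P i *m P j = 0,
      \sum_i P i = 1%:M
    & A = \sum_i (lambda i)%:C *: P i].

End QuantumMechanics.

Section DiscreteTrajectory.
Variables (R : realType) (K N p : nat).
Local Notation C := R[i].
Local Notation op0 := 'M[C]_K.+1.
Local Notation op := 'M[C]_(K.+1 * N.+1).
Variables (X : 'I_N.+1 -> 'cV[C]_N.+1) (P : 'I_p.+1 -> 'M[C]_N.+1).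

(* The block M_kl of M = \sum_(k, l) M_kl ⊗ |X_k><X_l| (see blockE below): its
   (a, b) entry is <e_a ⊗ X_k, M (e_b ⊗ X_l)>, (e_a) being the canonical basis
   of C^(K+1). *)
Definition block (M : op) (k l : 'I_N.+1) : op0 :=
  \matrix_(a, b) \sum_c \sum_e
    (X k c 0)^* * M (mxtens.mxtens_index (a, c)) (mxtens.mxtens_index (b, e))
      * X l e 0.

Lemma basis_complete (c c' : 'I_N.+1) : orthonormal_basis X ->
  \sum_k (X k c' 0)^* * X k c 0 = (c == c')%:R.
Proof.
move=> hX; pose Y : 'M[C]_N.+1 := \matrix_(a, k) X k a 0.
have YY : Y^t* *m Y = 1%:M.
  apply/matrixP => k l; rewrite !mxE -hX !mxE.
  by apply: eq_bigr => j _; rewrite !mxE.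
have := congr1 (fun Z : 'M[C]_N.+1 => Z c c') (mulmx1C YY).
rewrite !mxE => <-; apply: eq_bigr => k _.
by rewrite !mxE mulrC.
Qed.

Lemma blockE (M : op) : orthonormal_basis X ->
  M = \sum_k \sum_l block M k l ⊗ ketbra X k l.
Proof.
move=> hX; apply/matrixP => r s.
case: (mxtens.mxtens_indexP r) => a c; case: (mxtens.mxtens_indexP s) => b e.
pose m c' e' :=
  M (mxtens.mxtens_index (a, c')) (mxtens.mxtens_index (b, e')).
transitivity (\sum_c' \sum_e' m c' e' * (\sum_k (X k c' 0)^* * X k c 0)
                                       * (\sum_l (X l e 0)^* * X l e' 0)).
  rewrite (bigD1 c)//= (bigD1 e)//= !basis_complete// !eqxx !mulr1.
  rewrite big1 => [|e' ne]; last by rewrite !basis_complete// (negbTE ne) mulr0.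
  rewrite big1 ?addr0// => c' nc; rewrite big1// => e' _.
  by rewrite !basis_complete// eq_sym (negbTE nc) mulr0 mul0r.
rewrite summxE; under [RHS]eq_bigr => k _.
  rewrite summxE; under eq_bigr => l _.
    rewrite mxtens.tensmxE !mxE big_ord1 !mxE mulr_suml.
    under eq_bigr do rewrite mulr_suml.
    over.
  over.
rewrite /= [RHS](eq_bigr (fun k => \sum_c' \sum_e' \sum_l
  (m c' e' * ((X k c' 0)^* * X k c 0) * ((X l e 0)^* * X l e' 0)))); last first.
  move=> k _; rewrite exchange_big; apply: eq_bigr => c' _.
  rewrite exchange_big; apply: eq_bigr => e' _; apply: eq_bigr => l _.
  rewrite -/(m c' e') [(X k c' 0)^* * _]mulrC mulrACA -mulrA -mulrA.
  by rewrite -!mulrA; do 3!congr (_ * _); rewrite mulrC.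
rewrite [RHS]exchange_big /=; apply: eq_bigr => c' _.
rewrite [RHS]exchange_big /=; apply: eq_bigr => e' _.
rewrite -mulrA mulr_suml mulr_sumr; apply: eq_bigr => k _.
by rewrite mulrA mulr_sumr.
Qed.

Definition ptrace (M : op) : op0 := \sum_k block M k k.

(* p^i_kl = <X_l, P_i X_k> *)
Definition pcoef (i : 'I_p.+1) (k l : 'I_N.+1) : C :=
  ((X l)^t* *m P i *m X k) 0 0.

Definition idxI : {set 'I_p.+1} :=
  [set i | (i != ord0) && (pcoef i ord0 ord0 == 0)]%SET.

Definition idxJ : {set 'I_p.+1} := ([set~ ord0] :\: idxI)%SET.

Section Chain.
Variable U : op.

Definition evolved (rho : op0) : op :=
  U *m (rho ⊗ ketbra X ord0 ord0) *m U^t*.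

Definition prob (i : 'I_p.+1) (rho : op0) : C :=
  \tr (evolved rho *m (1%:M ⊗ P i)).

Definition postmeas (i : 'I_p.+1) (rho : op0) : op0 :=
  (prob i rho)^-1 *:
    ptrace ((1%:M ⊗ P i) *m evolved rho *m (1%:M ⊗ P i)).

(* prob i rho is a nonnegative real number when rho is a state, whence Re.
   When it is 0, the inverse in postmeas is the junk value 0, but the i-th
   term vanishes. *)
Definition gen_discrete (n : nat) (f : opE R K -> R) (rho : op0) : R :=
  n%:R * \sum_i (f (toE (postmeas i rho)) - f (toE rho))
                * complex.Re (prob i rho).

End Chain.

Section Limit.
(* L k stands for L_k0. *)
Variable L : 'I_N.+1 -> op0.

Definition drift (rho : op0) : op0 :=
  L ord0 *m rho + rho *m (L ord0)^t*
  + \sum_(k | k != ord0) L k *m rho *m (L k)^t*.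

Definition jump_num (i : 'I_p.+1) (rho : op0) : op0 :=
  \sum_(k | k != ord0) \sum_(l | l != ord0)
    pcoef i k l *: (L k *m rho *m (L l)^t*).

Definition intensity (i : 'I_p.+1) (rho : op0) : C := \tr (jump_num i rho).

Definition jump (i : 'I_p.+1) (rho : op0) : op0 :=
  (intensity i rho)^-1 *: jump_num i rho - rho.

Definition diff_num (i : 'I_p.+1) (rho : op0) : op0 :=
  \sum_(k | k != ord0) (pcoef i k ord0 *: (L k *m rho)
                        + pcoef i ord0 k *: (rho *m (L k)^t*)).

Definition diff_coef (i : 'I_p.+1) (rho : op0) : op0 :=
  (sqrtC (pcoef i ord0 ord0))^-1 *:
    (diff_num i rho - \tr (diff_num i rho) *: rho).

(* The kernel \sum_(i in B) v_i(rho) \d_(g_i(rho)); v_i(rho) is a nonnegative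
   real number when rho is a state, whence Re. *)
Definition jump_measure (B : {set 'I_p.+1}) (rho : op0)
    (S : set (borelE R K)) : \bar R :=
  (\sum_(i in B) (complex.Re (intensity i rho))%:E
                 * \d_(toE (jump i rho) : borelE R K) S)%E.

Definition jump_part (B : {set 'I_p.+1}) (f : opE R K -> R) (rho : op0) : R :=
  fine (\int[jump_measure B rho]_(mu in [set: borelE R K])
    (f (toE rho + mu) - f (toE rho) - D1 f (toE rho) mu)%:E)%E.

Definition gen_jump (f : opE R K -> R) (rho : op0) : R :=
  D1 f (toE rho) (toE (drift rho)) + jump_part [set~ ord0]%SET f rho.

Definition gen_jump_diffusion (f : opE R K -> R) (rho : op0) : R :=
  D1 f (toE rho) (toE (drift rho))
  + 2^-1 * \sum_(i in ord0 |: idxJ)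
             D2 f (toE rho) (toE (diff_coef i rho)) (toE (diff_coef i rho))
  + jump_part idxI f rho.

End Limit.

End DiscreteTrajectory.

Definition unif_cvg_on_states (R : realType) (K : nat)
    (F : nat -> 'M[R[i]]_K.+1 -> R) (G : 'M[R[i]]_K.+1 -> R) : Prop :=
  ereal_sup [set `|F n rho - G rho|%:E | rho in @states R K.+1]
    @[n --> \oo] --> (0 : \bar R)%E.

(* Main.v *)
(* Write V_k = U_k0(n) and N_i = \sum_(k, l) p^i_kl V_k rho V_l^*, so that the
   i-th outcome has probability Tr N_i and leads to N_i / Tr N_i. Subtract from
   the i-th term of the discrete generator the first-order quantity
   D_rho f(n (N_i - Tr(N_i) rho)). As \sum_i N_i = \sum_k V_k rho V_k^* and
   \sum_i Tr N_i = 1, these quantities add up to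
   D_rho f(n (\sum_k V_k rho V_k^* - rho)), which converges to the drift: the
   terms of order sqrt(n) never appear. If p^i_00 = 0, then P_i X_0 = 0, so that
   n N_i converges and the remainder of the i-th term tends to a jump term. If
   p^i_00 <> 0, then sqrt(n) (N_i - Tr(N_i) rho) converges and a second-order
   Taylor expansion turns the remainder into the i-th diffusion term.
   Uniformity comes from compactness: it is enough to prove convergence along
   filters on which n tends to infinity and the state converges. *)
Require Import Defs.
From HB Require Import structures.
From mathcomp Require Import all_boot all_order all_algebra.
From mathcomp Require Import complex.
From mathcomp Require Import all_classical all_reals all_analysis.
From mathcomp Require Import measurable_realfun ring lra.

Set Implicit Arguments.
Unset Strict Implicit.
Unset Printing Implicit Defensive.

Import Order.TTheory GRing.Theory Num.Theory.
Import numFieldNormedType.Exports.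

Local Open Scope classical_set_scope.
Local Open Scope sesquilinear_scope.
Local Open Scope ring_scope.
Local Open Scope complex_scope.

(** * Blocks of operators on the tensor product, and the outcomes of the measurement *)

Section BlockAlgebra.
Variable R : realType.
Local Notation C := R[i].

Lemma trmxC_mul m n q (A : 'M[C]_(m, n)) (B : 'M[C]_(n, q)) :
  (A *m B)^t* = B^t* *m A^t*.
Proof. by rewrite trmx_mul map_mxM. Qed.

Lemma trmxC_sum m n (I : finType) (A : I -> 'M[C]_(m, n)) :
  (\sum_i A i)^t* = \sum_i (A i)^t*.
Proof. by rewrite raddf_sum map_mx_sum. Qed.

Lemma tens_trmxC m n q r (A : 'M[C]_(m, n)) (B : 'M[C]_(q, r)) :
  (A ⊗ B)^t* = A^t* ⊗ B^t*.
Proof. by rewrite mxtens.trmx_tens mxtens.map_mxT. Qed.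

Lemma tens_sumr m n q r (I : finType) (A : 'M[C]_(m, n))
    (B : I -> 'M[C]_(q, r)) : A ⊗ (\sum_i B i) = \sum_i (A ⊗ B i).
Proof.
apply/matrixP => a b; rewrite summxE.
case: (mxtens.mxtens_indexP a) => a0 a1; case: (mxtens.mxtens_indexP b) => b0 b1.
rewrite mxtens.tensmxE summxE mulr_sumr.
by apply: eq_bigr => i _; rewrite mxtens.tensmxE.
Qed.

Lemma tr_tens m q (A : 'M[C]_m) (B : 'M[C]_q) : \tr (A ⊗ B) = \tr A * \tr B.
Proof.
rewrite /mxtrace mxtens.mulr_sum; apply: eq_bigr => k _.
by case: (mxtens.mxtens_indexP k) => i j; rewrite mxtens.tensmxE mxtens.mxtens_indexK.
Qed.

Variables (K N p : nat) (X : 'I_N.+1 -> 'cV[C]_N.+1).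
Hypothesis hX : orthonormal_basis X.
Implicit Types (S rho : 'M[C]_K.+1) (M : 'M[C]_(K.+1 * N.+1)).

Lemma trmxC_ketbra k l : (ketbra X k l)^t* = ketbra X l k.
Proof. by rewrite /ketbra trmxC_mul trmxCK. Qed.

Lemma ketbra_mul k l k' l' :
  ketbra X k l *m ketbra X k' l' = (l == k')%:R *: ketbra X k l'.
Proof.
rewrite /ketbra mulmxA -(mulmxA (X k)) [_^t* *m X k']mx11_scalar hX.
by rewrite mul_mx_scalar -scalemxAl.
Qed.

Lemma tr_ketbra_mul (Q : 'M[C]_N.+1) k l :
  \tr (ketbra X k l *m Q) = ((X l)^t* *m Q *m X k) 0 0.
Proof. by rewrite /ketbra -mulmxA mxtrace_mulC -[LHS]mulr1n trace_mx11. Qed.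

Lemma sum_ketbra : \sum_k ketbra X k k = 1%:M.
Proof.
apply/matrixP => a b; rewrite summxE !mxE -(basis_complete _ _ hX).
by apply: eq_bigr => k _; rewrite !mxE big_ord1 !mxE mulrC.
Qed.

Lemma block_tens S (Q : 'M[C]_N.+1) k l :
  block X (S ⊗ Q) k l = ((X k)^t* *m Q *m X l) 0 0 *: S.
Proof.
apply/matrixP => a b; rewrite !mxE.
under [in RHS]eq_bigr => e _ do rewrite !mxE mulr_suml.
rewrite exchange_big /= mulr_suml; apply: eq_bigr => c _.
rewrite mulr_suml; apply: eq_bigr => e _.
by rewrite mxtens.tensmxE !mxE; ring.
Qed.

Lemma block_sum (I : finType) (F : I -> 'M[C]_(K.+1 * N.+1)) k l :
  block X (\sum_i F i) k l = \sum_i block X (F i) k l.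
Proof.
apply/matrixP => a b; rewrite summxE !mxE.
under [in RHS]eq_bigr do rewrite !mxE.
rewrite [RHS]exchange_big; apply: eq_bigr => c _.
rewrite [RHS]exchange_big; apply: eq_bigr => e _.
by rewrite summxE mulr_sumr mulr_suml.
Qed.

Lemma ptrace_tens S (Q : 'M[C]_N.+1) : ptrace X (S ⊗ Q) = \tr Q *: S.
Proof.
rewrite /ptrace; under eq_bigr do rewrite block_tens -tr_ketbra_mul.
by rewrite -scaler_suml -raddf_sum -mulmx_suml sum_ketbra mul1mx.
Qed.

Lemma ptrace_sum (I : finType) (F : I -> 'M[C]_(K.+1 * N.+1)) :
  ptrace X (\sum_i F i) = \sum_i ptrace X (F i).
Proof.
rewrite /ptrace; under eq_bigr do rewrite block_sum.
by rewrite exchange_big.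
Qed.

(** As rho is tensored with |X_0><X_0|, the products of [ketbra]s retain only the blocks U_k0 on the
    left and their adjoints on the right. *)
Lemma evolvedE (U : 'M[C]_(K.+1 * N.+1)) rho :
  evolved X U rho = \sum_k \sum_l
    (block X U k ord0 *m rho *m (block X U l ord0)^t*) ⊗ ketbra X k l.
Proof.
pose V k := block X U k ord0.
have UE : U *m (rho ⊗ ketbra X ord0 ord0) =
    \sum_k (V k *m rho) ⊗ ketbra X k ord0.
  rewrite {1}(blockE U hX) mulmx_suml; apply: eq_bigr => k _.
  rewrite mulmx_suml (bigD1 ord0) //= big1 => [|l nl].
    by rewrite mxtens.tensmx_mul ketbra_mul eqxx scale1r addr0.
  by rewrite mxtens.tensmx_mul ketbra_mul (negbTE nl) scale0r mxtens.tensmx0.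
rewrite /evolved UE mulmx_suml; apply: eq_bigr => k _.
rewrite {1}(blockE U hX) trmxC_sum mulmx_sumr; apply: eq_bigr => l _.
rewrite trmxC_sum mulmx_sumr (bigD1 ord0) //= big1 => [|m nm].
  by rewrite tens_trmxC trmxC_ketbra mxtens.tensmx_mul ketbra_mul eqxx scale1r addr0.
rewrite tens_trmxC trmxC_ketbra mxtens.tensmx_mul ketbra_mul eq_sym.
by rewrite (negbTE nm) scale0r mxtens.tensmx0.
Qed.

Variables (P : 'I_p.+1 -> 'M[C]_N.+1) (A : 'M[C]_N.+1) (lambda : 'I_p.+1 -> R).
Hypothesis hP : spectral_decomposition A lambda P.

(** The operator N_i, for an arbitrary family [V] in place of the blocks U_k0, so that the jump
    numerator is covered as well. *)
Definition sandwich (V : 'I_N.+1 -> 'M[C]_K.+1) (i : 'I_p.+1) rho :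
    'M[C]_K.+1 :=
  \sum_k \sum_l pcoef X P i k l *: (V k *m rho *m (V l)^t*).

(** Cyclicity of the trace on the second factor and P_i^2 = P_i merge the two projectors into
    one. *)
Lemma ptrace_measure (U : 'M[C]_(K.+1 * N.+1)) i rho :
  ptrace X ((1%:M ⊗ P i) *m evolved X U rho *m (1%:M ⊗ P i)) =
  sandwich (block X U ^~ ord0) i rho.
Proof.
have [_ /(_ i)[_ _ PP] _ _ _] := hP.
rewrite evolvedE /sandwich mulmx_sumr mulmx_suml ptrace_sum.
apply: eq_bigr => k _; rewrite mulmx_sumr mulmx_suml ptrace_sum.
apply: eq_bigr => l _; rewrite !mxtens.tensmx_mul mul1mx mulmx1 ptrace_tens.
by rewrite mxtrace_mulC mulmxA PP mxtrace_mulC tr_ketbra_mul.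
Qed.

Lemma prob_trace (U : 'M[C]_(K.+1 * N.+1)) i rho :
  prob X P U i rho = \tr (sandwich (block X U ^~ ord0) i rho).
Proof.
rewrite /prob evolvedE /sandwich mulmx_suml !raddf_sum.
apply: eq_bigr => k _; rewrite mulmx_suml /= !raddf_sum.
apply: eq_bigr => l _; rewrite mxtens.tensmx_mul mulmx1 /= tr_tens.
by rewrite tr_ketbra_mul /= mxtraceZ mulrC.
Qed.

Lemma sum_pcoef k l : \sum_i pcoef X P i k l = (k == l)%:R.
Proof.
have [_ _ _ P1 _] := hP; rewrite [k == l]eq_sym.
rewrite -hX -(mulmx1 ((X l)^t*)) -P1 mulmx_sumr mulmx_suml summxE.
by [].
Qed.

(** Completeness of the projectors gives sum_i p^i_kl = delta_kl, which removes the cross terms: the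
    contributions of order sqrt(n) cancel between outcomes. *)
Lemma sum_sandwich V rho :
  \sum_i sandwich V i rho = \sum_k V k *m rho *m (V k)^t*.
Proof.
rewrite exchange_big; apply: eq_bigr => k _ /=.
rewrite exchange_big [LHS](bigD1 k) //= [X in _ + X]big1 => [|l nl];
  rewrite -scaler_suml sum_pcoef.
  by rewrite eqxx scale1r addr0.
by rewrite eq_sym (negbTE nl) scale0r.
Qed.

Lemma sum_prob (U : 'M[C]_(K.+1 * N.+1)) rho : U \is unitarymx ->
  \sum_i prob X P U i rho = \tr rho.
Proof.
move=> hU; have [_ _ _ P1 _] := hP.
rewrite /prob -raddf_sum /= -mulmx_sumr -tens_sumr P1.
have -> : 1%:M ⊗ 1%:M = 1%:M :> 'M[C]_(K.+1 * N.+1).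
  apply/matrixP => a b.
  case: (mxtens.mxtens_indexP a) => a0 a1; case: (mxtens.mxtens_indexP b) => b0 b1.
  rewrite mxtens.tensmxE !mxE -natrM mulnb.
  by rewrite (inj_eq (can_inj (@mxtens.mxtens_indexK _ _))) xpair_eqE.
rewrite mulmx1 /evolved mxtrace_mulC mulmxA.
move/unitarymxP: hU => /mulmx1C ->.
by rewrite mul1mx tr_tens -[ketbra _ _ _]mulmx1 tr_ketbra_mul mulmx1 hX eqxx mulr1.
Qed.

Lemma pcoef_mul i k l :
  pcoef X P i k l = \sum_c (P i *m X k) c 0 * ((P i *m X l) c 0)^*.
Proof.
have [_ /(_ i)[_ Ps PP] _ _ _] := hP.
rewrite /pcoef -{1}PP -{1}Ps mulmxA -trmxC_mul -mulmxA mxE.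
by apply: eq_bigr => c _; rewrite !mxE mulrC.
Qed.

(* Kraus form, from p^i_kl = <P_i X_l, P_i X_k>. *)
Lemma sandwichE V i rho :
  sandwich V i rho = \sum_c (\sum_k (P i *m X k) c 0 *: V k) *m rho
     *m (\sum_k (P i *m X k) c 0 *: V k)^t*.
Proof.
rewrite /sandwich; under eq_bigr => k _ do
  under eq_bigr => l _ do rewrite pcoef_mul scaler_suml.
under eq_bigr do rewrite exchange_big.
rewrite exchange_big; apply: eq_bigr => c _ /=.
rewrite 2!mulmx_suml; apply: eq_bigr => k _.
rewrite trmxC_sum mulmx_sumr; apply: eq_bigr => l _.
by rewrite linearZ /= map_mxZ -scalemxAr -!scalemxAl scalerA mulrC.
Qed.

Lemma pcoef_ge0 i k : 0 <= pcoef X P i k k.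
Proof. by rewrite pcoef_mul; apply: sumr_ge0 => c _; rewrite mul_conjC_ge0. Qed.

(** p^i_kk is the squared norm of P_i X_k, so its vanishing gives P_i X_k = 0, and with it a whole
    row and column of zeros. *)
Lemma pcoef_eq0 i k l : pcoef X P i k k = 0 ->
  pcoef X P i k l = 0 /\ pcoef X P i l k = 0.
Proof.
move=> /eqP; rewrite pcoef_mul psumr_eq0 => [/allP h|c _]; last first.
  by rewrite mul_conjC_ge0.
have z c : (P i *m X k) c 0 = 0.
  have := h c; rewrite mem_index_enum => /(_ isT) /=.
  by rewrite mul_conjC_eq0 => /eqP.
by rewrite !pcoef_mul !big1 // => c _; rewrite z ?mul0r // conjC0 mulr0.
Qed.

End BlockAlgebra.

(** * Positive operators: conjugation and trace *)

Section States.
Variable R : realType.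
Local Notation C := R[i].

Lemma positive_op_conj m n (M : 'M[C]_m) (W : 'M[C]_(n, m)) :
  positive_op M -> positive_op (W *m M *m W^t*).
Proof.
move=> h u; have := h (W^t* *m u).
by rewrite trmxC_mul trmxCK !mulmxA.
Qed.

Lemma positive_op_tr m (M : 'M[C]_m) : positive_op M -> 0 <= \tr M.
Proof.
move=> h; apply: sumr_ge0 => i _; have := h (delta_mx i 0).
rewrite trmx_delta map_delta_mx -rowE -colE !mxE.
by [].
Qed.

End States.

(** * Limits of complex numbers and matrices along a filter *)

Section ComplexLimits.
Variables (R : realType) (T : Type) (F : set_system T).
Context {FF : Filter F}.
Local Notation C := R[i].

(** Stated on real and imaginary parts to match [toE], so that every limit reduces to real ones. *)
Definition cvgc (z : T -> C) (c : C) : Prop :=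
  (complex.Re (z t) @[t --> F] --> complex.Re c) /\
  (complex.Im (z t) @[t --> F] --> complex.Im c).

Definition cvgcm m n (M : T -> 'M[C]_(m, n)) (M0 : 'M[C]_(m, n)) : Prop :=
  forall a b, cvgc (fun t => M t a b) (M0 a b).

Lemma ReM (x y : C) : complex.Re (x * y) =
  complex.Re x * complex.Re y - complex.Im x * complex.Im y.
Proof. by case: x y => [a b] []. Qed.

Lemma ImM (x y : C) : complex.Im (x * y) =
  complex.Re x * complex.Im y + complex.Im x * complex.Re y.
Proof. by case: x y => [a b] []. Qed.

Lemma ReD (x y : C) : complex.Re (x + y) = complex.Re x + complex.Re y.
Proof. by case: x y => [a b] []. Qed.

Lemma ImD (x y : C) : complex.Im (x + y) = complex.Im x + complex.Im y.
Proof. by case: x y => [a b] []. Qed.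

Lemma ReN (x : C) : complex.Re (- x) = - complex.Re x.
Proof. by case: x. Qed.

Lemma ImN (x : C) : complex.Im (- x) = - complex.Im x.
Proof. by case: x. Qed.

Lemma ReV (x : C) : complex.Re x^-1 =
  complex.Re x / (complex.Re x ^+ 2 + complex.Im x ^+ 2).
Proof. by case: x. Qed.

Lemma ImV (x : C) : complex.Im x^-1 =
  - (complex.Im x / (complex.Re x ^+ 2 + complex.Im x ^+ 2)).
Proof. by case: x. Qed.

Lemma cvgc_cst c : cvgc (fun=> c) c.
Proof. by split; exact: cvg_cst. Qed.

Lemma cvgcD z z' c c' : cvgc z c -> cvgc z' c' -> cvgc (fun t => z t + z' t) (c + c').
Proof.
move=> [h1 h2] [h3 h4]; split; rewrite ?ReD ?ImD.
  by under eq_fun do rewrite ReD; exact: cvgD.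
by under eq_fun do rewrite ImD; exact: cvgD.
Qed.

Lemma cvgcN z c : cvgc z c -> cvgc (fun t => - z t) (- c).
Proof.
move=> [h1 h2]; split; rewrite ?ReN ?ImN.
  by under eq_fun do rewrite ReN; exact: cvgN.
by under eq_fun do rewrite ImN; exact: cvgN.
Qed.

Lemma cvgcM z z' c c' : cvgc z c -> cvgc z' c' -> cvgc (fun t => z t * z' t) (c * c').
Proof.
move=> [h1 h2] [h3 h4]; split; rewrite ?ReM ?ImM.
  by under eq_fun do rewrite ReM; apply: cvgB; exact: cvgM.
by under eq_fun do rewrite ImM; apply: cvgD; exact: cvgM.
Qed.

Lemma cvgcV z c : c != 0 -> cvgc z c -> cvgc (fun t => (z t)^-1) c^-1.
Proof.
move=> c0 [h1 h2]; have n0 : complex.Re c ^+ 2 + complex.Im c ^+ 2 != 0.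
  rewrite paddr_eq0 ?sqr_ge0// !sqrf_eq0; apply: contra c0.
  by rewrite eq_complex.
have hV : (complex.Re (z t) ^+ 2 + complex.Im (z t) ^+ 2)^-1 @[t --> F]
    --> (complex.Re c ^+ 2 + complex.Im c ^+ 2)^-1.
  by apply: cvgV => //; apply: cvgD; rewrite !expr2; exact: cvgM.
split; rewrite ?ReV ?ImV.
  by under eq_fun do rewrite ReV; exact: cvgM.
by under eq_fun do rewrite ImV; apply: cvgN; exact: cvgM.
Qed.

Lemma cvgc_conj z c : cvgc z c -> cvgc (fun t => (z t)^*%R) (c^*%R).
Proof.
have e (x : C) : x^*%R = complex.Re x -i* complex.Im x by case: x.
move=> [h1 h2]; split; rewrite e /=.
  by under eq_fun do rewrite e.
by under eq_fun do rewrite e; exact: cvgN.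
Qed.

Lemma cvgc_sum (I : Type) (r : seq I) (Q : pred I) (z : I -> T -> C) (c : I -> C) :
  (forall i, Q i -> cvgc (z i) (c i)) ->
  cvgc (fun t => \sum_(i <- r | Q i) z i t) (\sum_(i <- r | Q i) c i).
Proof.
move=> h; elim: r => [|i r IH].
  by rewrite big_nil; under eq_fun do rewrite big_nil; exact: cvgc_cst.
rewrite big_cons; under eq_fun do rewrite big_cons.
by case: ifP => // /h; move/cvgcD; exact.
Qed.

Lemma cvgc_real (x : T -> R) (l : R) :
  x t @[t --> F] --> l -> cvgc (fun t => (x t)%:C) l%:C.
Proof. by move=> h; split => //=; exact: cvg_cst. Qed.

Lemma cvgcm_cst m n (M : 'M[C]_(m, n)) : cvgcm (fun=> M) M.
Proof. by move=> a b; exact: cvgc_cst. Qed.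

Lemma cvgcmD m n (M M' : T -> 'M[C]_(m, n)) M0 M0' :
  cvgcm M M0 -> cvgcm M' M0' -> cvgcm (fun t => M t + M' t) (M0 + M0').
Proof.
move=> h h' a b; rewrite mxE; under eq_fun do rewrite mxE.
exact: cvgcD.
Qed.

Lemma cvgcmN m n (M : T -> 'M[C]_(m, n)) M0 :
  cvgcm M M0 -> cvgcm (fun t => - M t) (- M0).
Proof.
move=> h a b; rewrite mxE; under eq_fun do rewrite mxE.
exact: cvgcN.
Qed.

Lemma cvgcmM m n q (M : T -> 'M[C]_(m, n)) (M' : T -> 'M[C]_(n, q)) M0 M0' :
  cvgcm M M0 -> cvgcm M' M0' -> cvgcm (fun t => M t *m M' t) (M0 *m M0').
Proof.
move=> h h' a b; rewrite mxE; under eq_fun do rewrite mxE.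
by apply: cvgc_sum => i _; exact: cvgcM.
Qed.

Lemma cvgcmZ m n (z : T -> C) (M : T -> 'M[C]_(m, n)) c M0 :
  cvgc z c -> cvgcm M M0 -> cvgcm (fun t => z t *: M t) (c *: M0).
Proof.
move=> h h' a b; rewrite mxE; under eq_fun do rewrite mxE.
exact: cvgcM.
Qed.

Lemma cvgcmZ0 m n (z : T -> C) (M : T -> 'M[C]_(m, n)) M0 :
  cvgc z 0 -> cvgcm M M0 -> cvgcm (fun t => z t *: M t) 0.
Proof.
move=> h h' a b; rewrite mxE; under eq_fun do rewrite mxE.
by rewrite -(mul0r (M0 a b)); exact: cvgcM.
Qed.

Lemma cvgcm_trmxC m n (M : T -> 'M[C]_(m, n)) M0 :
  cvgcm M M0 -> cvgcm (fun t => (M t)^t*) (M0^t*).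
Proof.
move=> h a b; rewrite !mxE; under eq_fun do rewrite !mxE.
exact: cvgc_conj.
Qed.

Lemma cvgcm_sum m n (I : Type) (r : seq I) (Q : pred I)
    (M : I -> T -> 'M[C]_(m, n)) (M0 : I -> 'M[C]_(m, n)) :
  (forall i, Q i -> cvgcm (M i) (M0 i)) ->
  cvgcm (fun t => \sum_(i <- r | Q i) M i t) (\sum_(i <- r | Q i) M0 i).
Proof.
move=> h a b; rewrite summxE; under eq_fun do rewrite summxE.
by apply: cvgc_sum => i /h; exact.
Qed.

Lemma cvgcm_tr m (M : T -> 'M[C]_m) M0 :
  cvgcm M M0 -> cvgc (fun t => \tr (M t)) (\tr M0).
Proof. by move=> h; apply: cvgc_sum. Qed.

Lemma near_eq_cvgcm m n (M M' : T -> 'M[C]_(m, n)) M0 :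
  (\forall t \near F, M t = M' t) -> cvgcm M M0 -> cvgcm M' M0.
Proof.
move=> e h a b; have [h1 h2] := h a b; split.
  by apply: cvg_trans h1; apply: near_eq_cvg; apply: filterS e => t ->.
by apply: cvg_trans h2; apply: near_eq_cvg; apply: filterS e => t ->.
Qed.

Lemma cvg_mxP m n (M : T -> 'M[R]_(m, n)) (M0 : 'M[R]_(m, n)) :
  M t @[t --> F] --> M0 <-> forall i j, M t i j @[t --> F] --> M0 i j.
Proof.
split=> [h i j|h A [B MB sBA]].
  by apply: (cvg_comp M (fun N : 'M[R]_(m, n) => N i j) h); exact: coord_continuous.
apply: (@filterS _ F FF (fun t => forall i j, B i j (M t i j))) => [t|].
  exact: sBA.
apply: filter_forall => i; apply: filter_forall => j; exact: h (MB i j).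
Qed.

Variable K : nat.

(** The bridge between the normed space E, where the test functions live, and the complex matrices,
    where limits are computed entry by entry. *)
Lemma cvg_toEP (M : T -> 'M[C]_K.+1) M0 :
  toE (M t) @[t --> F] --> toE M0 <-> cvgcm M M0.
Proof.
split=> [h|h].
  have h1 : (toE (M t)).1 @[t --> F] --> (toE M0).1 by apply: cvg_comp h cvg_fst.
  have h2 : (toE (M t)).2 @[t --> F] --> (toE M0).2 by apply: cvg_comp h cvg_snd.
  move=> a b; move/cvg_mxP: h1 => /(_ a b); move/cvg_mxP: h2 => /(_ a b).
  rewrite /toE !mxE; under eq_fun do rewrite mxE.
  by move=> h2; under eq_fun do rewrite mxE.
have h1 : map_mx (@complex.Re R) (M t) @[t --> F] --> map_mx (@complex.Re R) M0.
  apply/cvg_mxP => a b; rewrite mxE; under eq_fun do rewrite mxE.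
  exact: (h a b).1.
have h2 : map_mx (@complex.Im R) (M t) @[t --> F] --> map_mx (@complex.Im R) M0.
  apply/cvg_mxP => a b; rewrite mxE; under eq_fun do rewrite mxE.
  exact: (h a b).2.
exact: (cvg_pair h1 h2).
Qed.

End ComplexLimits.

(** * Taylor's formula of order two with Lagrange remainder *)

Section SecondOrderTaylor.
Variable R : realType.

Lemma taylor_lagrange2 (phi phi1 phi2 : R -> R) :
  (forall t : R, is_derive t 1 phi (phi1 t)) ->
  (forall t : R, is_derive t 1 phi1 (phi2 t)) ->
  exists2 c, 0 < c < 1 & phi 1 = phi 0 + phi1 0 + 2^-1 * phi2 c.
Proof.
move=> d1 d2.
(* Rolle for phi t + (1 - t) phi1 t + r (1 - t)^2, which takes the value phi 1
   at both ends. *)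
pose r := phi 1 - phi 0 - phi1 0.
pose psi := fun t : R => phi t + (1 - t) * phi1 t + r * (1 - t) ^+ 2.
have dpsi (t : R) : is_derive t 1 psi ((1 - t) * (phi2 t - 2 * r)).
  rewrite /psi; apply: is_derive_eq.
  by rewrite /GRing.scale /=; ring.
have [||||c c01] := @Rolle R psi 0 1.
- exact: ltr01.
- by move=> x _; apply: ex_derive.
- apply: continuous_subspaceT => x; apply: differentiable_continuous.
  by apply/derivable1_diffP; apply: ex_derive.
- by rewrite /psi /r; ring.
move=> [_]; have [_ ->] := dpsi c.
move: c01; rewrite in_itv /= => c01 /eqP; rewrite mulf_eq0 subr_eq0 => /orP[/eqP c1|].
  by move: c01; rewrite -c1 ltxx andbF.
rewrite subr_eq0 => /eqP e; exists c => //.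
by rewrite e /r; field.
Qed.

Lemma is_derive_line (V : normedModType R) (f : V -> R) (x h : V) (t : R) :
  differentiable f (x + t *: h) ->
  is_derive t 1 (fun s : R => f (x + s *: h)) ('d f (x + t *: h) h).
Proof.
move=> df; have dv := @diff_derivable _ _ _ f _ h df; rewrite -(deriveE _ df).
(* The two difference quotients are the same function of [s], so derivability and the value of the
   derivative transfer together. *)
have e : (fun s : R => s^-1 *: (((fun s : R => f (x + s *: h)) \o shift t) (s *: 1)
            - f (x + t *: h))) =
         (fun s : R => s^-1 *: ((f \o shift (x + t *: h)) (s *: h) - f (x + t *: h))).
  apply/funext => s /=; congr (_ *: (f _ - _)).
  by rewrite [s *: 1]mulr1 scalerDl addrCA.
by split; rewrite /derivable /derive e.
Qed.

End SecondOrderTaylor.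

(** * Joint continuity of linear forms in finite dimension *)

Section JointContinuity.
Variables (R : realType) (K : nat) (T : Type) (F : set_system T).
Context {FF : Filter F}.
Local Notation E := (opE R K).

Lemma cvgr_sum (I : Type) (r : seq I) (Q : pred I) (u : I -> T -> R) (l : I -> R) :
  (forall i, Q i -> u i t @[t --> F] --> l i) ->
  \sum_(i <- r | Q i) u i t @[t --> F] --> \sum_(i <- r | Q i) l i.
Proof. by move=> h; apply: cvg_big => //; exact: add_continuous. Qed.

Lemma opE_basis (u : E) :
  u = \sum_i \sum_j (u.1 i j *: ((delta_mx i j, 0) : E)
                     + u.2 i j *: ((0, delta_mx i j) : E)).
Proof.
have e1 (I : finType) (G : I -> E) : (\sum_i G i).1 = \sum_i (G i).1.
  by elim/big_rec2: _ => //= i y1 y2 _ <-.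
have e2 (I : finType) (G : I -> E) : (\sum_i G i).2 = \sum_i (G i).2.
  by elim/big_rec2: _ => //= i y1 y2 _ <-.
rewrite [LHS]surjective_pairing [RHS]surjective_pairing; congr (_, _).
  rewrite {1}[u.1]matrix_sum_delta e1; apply: eq_bigr => i _.
  by rewrite e1; apply: eq_bigr => j _ /=; rewrite scaler0 addr0.
rewrite {1}[u.2]matrix_sum_delta e2; apply: eq_bigr => i _.
by rewrite e2; apply: eq_bigr => j _ /=; rewrite scaler0 add0r.
Qed.

Lemma linear_opE (g : E -> R) (u : E) : linear (g : E -> R^o) ->
  g u = \sum_i \sum_j (u.1 i j * g (delta_mx i j, 0) + u.2 i j * g (0, delta_mx i j)).
Proof.
(* Packing [g] as a linear map gives access to the algebraic lemmas on linear maps. *)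
move=> lg; pose lg' := GRing.isLinear.Build _ _ _ _ g lg.
pose G : {linear E -> R^o} := HB.pack g lg'.
rewrite -[LHS]/(G u) {1}(opE_basis u) linear_sum; apply: eq_bigr => i _.
by rewrite linear_sum; apply: eq_bigr => j _; rewrite linearD !linearZ.
Qed.

(** Expanding the moving argument in a basis leaves finitely many products of a convergent
    coordinate and a convergent value at a fixed vector. The direction-by-direction C^2 condition
    thus yields joint continuity of the differentials. *)
Lemma cvg_linear_apply (g : T -> E -> R) (g0 : E -> R) (u : T -> E) (u0 : E) :
  (forall t, linear (g t : E -> R^o)) -> linear (g0 : E -> R^o) ->
  (forall v, g t v @[t --> F] --> g0 v) -> u t @[t --> F] --> u0 ->
  g t (u t) @[t --> F] --> g0 u0.
Proof.
move=> lg lg0 cg cu.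
have h1 : (u t).1 @[t --> F] --> u0.1 by apply: cvg_comp cu cvg_fst.
have h2 : (u t).2 @[t --> F] --> u0.2 by apply: cvg_comp cu cvg_snd.
rewrite (linear_opE u0 lg0); under eq_fun do rewrite (linear_opE _ (lg _)).
apply: cvgr_sum => i _; apply: cvgr_sum => j _.
by apply: cvgD; apply: cvgM => //; [move/cvg_mxP: h1; exact|move/cvg_mxP: h2; exact].
Qed.

End JointContinuity.

(** * Test functions: bilinearity of the second differential, boundedness, Taylor expansion,
    continuity *)

Section TestFunction.
Variables (R : realType) (K : nat) (f : opE R K -> R).
Local Notation E := (opE R K).
Hypothesis fC2 : C2c f.

Lemma C2c_diff x : differentiable f x. Proof. by case: fC2. Qed.

Lemma C2c_diff1 v x : differentiable (fun y => D1 f y v) x.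
Proof. by case: fC2. Qed.

Lemma D1_linear x : linear (D1 f x : E -> R^o).
Proof. by move=> a u v; rewrite /D1 linearP. Qed.

Lemma D2_linearl x v : linear ((fun u => D2 f x u v) : E -> R^o).
Proof. by move=> a u w; rewrite /D2 linearP. Qed.

(** Here the direction sits inside the function being differentiated: linearity comes from that of
    D_y f at every [y], then from linearity of the differential in the function. *)
Lemma D2_linearr x u : linear (D2 f x u : E -> R^o).
Proof.
move=> a v w; rewrite /D2.
have -> : (fun y => D1 f y (a *: v + w)) =
    a *: (fun y => D1 f y v) + (fun y => D1 f y w) :> (E -> R).
  by apply/funext => y; exact: D1_linear.
have dv := C2c_diff1 v x; have dw := C2c_diff1 w x.
have dav : differentiable (a *: (fun y => D1 f y v)) x.
  exact: differentiableZ.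
by rewrite (diffD dav dw) (diffZ a dv).
Qed.

Lemma C2c_continuous : continuous f.
Proof. by move=> x; apply: differentiable_continuous; exact: C2c_diff. Qed.

Lemma C2c_bounded : exists M : R, forall x, `|f x| <= M.
Proof.
have [_ _ _ cf] := fC2.
have /compact_bounded[M [_ hM]] : compact (f @` closure [set x | f x != 0]).
  apply: continuous_compact cf; apply: continuous_subspaceT; exact: C2c_continuous.
(* Every real above [M] is a bound on the support, hence M + 1; the maximum with 0 serves the points
   where [f] vanishes. *)
exists (Num.max 0 (M + 1)) => x; rewrite le_max; have [->|fx] := eqVneq (f x) 0.
  by rewrite normr0 lexx.
apply/orP; right; apply: (hM (M + 1)); first by rewrite ltrDl.
by exists x => //; exact: subset_closure.
Qed.

Lemma C2c_taylor (x h : E) : exists2 c : R, 0 < c < 1 &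
  f (x + h) = f x + D1 f x h + 2^-1 * D2 f (x + c *: h) h h.
Proof.
have [t|t|c c01] := @taylor_lagrange2 R (fun s : R => f (x + s *: h))
  (fun s : R => D1 f (x + s *: h) h) (fun s : R => D2 f (x + s *: h) h h).
- apply: is_derive_line; exact: C2c_diff.
- apply: (@is_derive_line _ _ (fun y => D1 f y h)); exact: C2c_diff1.
by rewrite scale1r scale0r addr0 => e; exists c.
Qed.

Variables (T : Type) (F : set_system T).
Context {FF : Filter F}.

Lemma cvg_D1 (x u : T -> E) (x0 u0 : E) : x t @[t --> F] --> x0 ->
  u t @[t --> F] --> u0 -> D1 f (x t) (u t) @[t --> F] --> D1 f x0 u0.
Proof.
move=> cx cu; apply: (@cvg_linear_apply _ _ _ _ _ (fun t => D1 f (x t))) => //.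
- by move=> t; exact: D1_linear.
- exact: D1_linear.
move=> v; apply: (cvg_comp x (fun y => D1 f y v) cx).
exact: (differentiable_continuous (C2c_diff1 v x0)).
Qed.

(** [cvg_linear_apply] is used once for each slot, down to the continuity of D^2 f at fixed
    directions. *)
Lemma cvg_D2 (x u v : T -> E) (x0 u0 v0 : E) : x t @[t --> F] --> x0 ->
  u t @[t --> F] --> u0 -> v t @[t --> F] --> v0 ->
  D2 f (x t) (u t) (v t) @[t --> F] --> D2 f x0 u0 v0.
Proof.
move=> cx cu cv.
apply: (@cvg_linear_apply _ _ _ _ _ (fun t => D2 f (x t) (u t))) => //.
- by move=> t; exact: D2_linearr.
- exact: D2_linearr.
move=> w.
apply: (@cvg_linear_apply _ _ _ _ _ (fun t u => D2 f (x t) u w)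
  (fun u => D2 f x0 u w)) => //.
- by move=> t; exact: D2_linearl.
- exact: D2_linearl.
move=> u'; apply: (cvg_comp x (fun y => D2 f y u' w) cx).
by case: fC2 => _ _ h _; exact: h.
Qed.

End TestFunction.

(** * Integration against finite weighted sums of Dirac masses *)

Section WeightedDirac.
Local Open Scope ereal_scope.

(** The integral in [jump_part] is taken against a bare set function; exhibiting such a function as
    a measure gives access to additivity and scaling of integrals. *)
Lemma sum_dirac_measure d (T : measurableType d) (R : realType) n
    (w : 'I_n.+1 -> R) (a : 'I_n.+1 -> T) : (forall i, (0 <= w i)%R) ->
  exists2 mu : {measure set T -> \bar R},
    (fun S : set T => \sum_i (w i)%:E * \d_(a i) S) = mu &
    forall h : T -> \bar R, (forall x, 0 <= h x) -> measurable_fun [set: T] h ->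
      \int[mu]_(x in [set: T]) h x = \sum_i (w i)%:E * h (a i).
Proof.
(* [msum] is indexed by naturals, so weights and atoms are read through [inord]. *)
move=> w0; pose m (k : nat) : {measure set T -> \bar R} :=
  mscale (NngNum (w0 (inord k))) (dirac (a (inord k))).
exists (msum m n.+1) => [|h h0 mh].
  apply/funext => S; rewrite /msum.
  by apply: eq_bigr => i _; rewrite /m/= /mscale/= inord_val.
rewrite ge0_integral_measure_sum //; apply: eq_bigr => i _.
by rewrite ge0_integral_mscale //= integral_dirac // diracT mul1e inord_val.
Qed.

(** Positive and negative parts are integrated separately; both integrals are finite, so their
    difference is computed in the reals. *)
Lemma integral_sum_dirac d (T : measurableType d) (R : realType) n
    (w : 'I_n.+1 -> R) (a : 'I_n.+1 -> T) (h : T -> R) :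
  (forall i, (0 <= w i)%R) -> measurable_fun [set: T] h ->
  \int[fun S : set T => \sum_i (w i)%:E * \d_(a i) S]_(x in [set: T]) (h x)%:E =
  (\sum_i w i * h (a i))%R%:E.
Proof.
move=> w0 mh; have mh' : measurable_fun [set: T] (EFin \o h) by exact/measurable_EFinP.
have [mu -> muE] := sum_dirac_measure a w0.
rewrite integralE !muE //; [|exact: measurable_funeneg|exact: measurable_funepos].
have e (g : \bar R -> \bar R) (r : T -> R) : (forall x, g (h x)%:E = (r x)%:E) ->
    \sum_i (w i)%:E * g (h (a i))%:E = (\sum_i w i * r (a i))%R%:E.
  by move=> gr; rewrite -sumEFin; apply: eq_bigr => i _; rewrite gr EFinM.
under eq_bigr do rewrite funeposE; under [X in _ - X]eq_bigr do rewrite funenegE.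
rewrite (e (fun z => maxe z 0) (fun x => Num.max (h x) 0)%R); last first.
  by move=> x; rewrite EFin_max.
rewrite (e (fun z => maxe (- z) 0) (fun x => Num.max (- h x) 0)%R); last first.
  by move=> x; rewrite EFin_max.
rewrite -EFinB -sumrB; congr EFin; apply: eq_bigr => i _.
rewrite -mulrBr; congr (_ * _)%R.
case: (ltrgt0P (h (a i))) => hi.
- by rewrite max_r ?subr0 // oppr_le0 ltW.
- by rewrite max_l ?sub0r ?opprK // oppr_ge0 ltW.
by rewrite ?hi ?oppr0 ?maxxx ?subr0.
Qed.

End WeightedDirac.

(** * The jump part of the generator as a finite sum *)

Section JumpPart.
Variables (R : realType) (K N p : nat).
Variables (X : 'I_N.+1 -> 'cV[R[i]]_N.+1) (P : 'I_p.+1 -> 'M[R[i]]_N.+1).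
Variables (L : 'I_N.+1 -> 'M[R[i]]_K.+1).

Lemma continuous_measurable_borelE (h : opE R K -> R) : continuous h ->
  measurable_fun [set: borelE R K] (h : borelE R K -> R).
Proof.
move=> /continuousP ch.
apply: (measurability _ (RGenOpens.measurableE R)) => _ [_ [r [s ->]] <-].
rewrite setTI; apply: sub_sigma_algebra; apply: ch; exact: interval_open.
Qed.

Lemma jump_partE (B : {set 'I_p.+1}) (f : opE R K -> R) (rho : 'M[R[i]]_K.+1) :
  C2c f -> (forall i, 0 <= intensity X P L i rho) ->
  jump_part X P L B f rho = \sum_(i in B) complex.Re (intensity X P L i rho) *
    (f (toE rho + toE (jump X P L i rho)) - f (toE rho)
     - D1 f (toE rho) (toE (jump X P L i rho))).
Proof.
move=> fC v0; rewrite /jump_part.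
(* Weights extended by 0 outside [B] let the sum run over all indices. *)
pose w i := if i \in B then complex.Re (intensity X P L i rho) else 0.
pose h (mu : opE R K) := f (toE rho + mu) - f (toE rho) - D1 f (toE rho) mu.
have w0 i : 0 <= w i.
  by rewrite /w; case: ifP => // _; have := v0 i; rewrite lecE => /andP[].
have -> : jump_measure X P L B rho = (fun S : set (borelE R K) =>
    \sum_i (w i)%:E * \d_(toE (jump X P L i rho) : borelE R K) S)%E.
  apply/funext => S; rewrite /jump_measure big_mkcond; apply: eq_bigr => i _.
  by rewrite /w; case: ifP; rewrite ?mul0e.
have mh : measurable_fun [set: borelE R K] (h : borelE R K -> R).
  apply: continuous_measurable_borelE => mu; apply: cvgB; last first.
    by apply: cvg_D1 => //; exact: cvg_cst.
  apply: cvgB; last exact: cvg_cst.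
  apply: (@cvg_comp _ _ _ (fun mu => toE rho + mu) f); last exact: C2c_continuous.
  by apply: cvgD => //; exact: cvg_cst.
rewrite (integral_sum_dirac _ w0 mh) /= [RHS]big_mkcond; apply: eq_bigr => i _.
by rewrite /w; case: ifP; rewrite ?mul0r.
Qed.

End JumpPart.

(** * Entries of a positive operator are bounded by its trace *)

Section StatesBounded.
Variable R : realType.
Local Notation C := R[i].

(* For z = 1, -1, i, -i these values bound the entries of a positive operator
   by its trace. *)
Lemma quad_form_delta m (M : 'M[C]_m) (a b : 'I_m) (z : C) :
  ((delta_mx a 0 + z *: delta_mx b 0 : 'cV[C]_m)^t* *m M
     *m (delta_mx a 0 + z *: delta_mx b 0 : 'cV[C]_m)) 0 0 =
  M a a + z * M a b + z^*%R * (M b a + z * M b b).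
Proof.
have -> : (delta_mx a 0 + z *: delta_mx b 0 : 'cV[C]_m)^t* =
    delta_mx 0 a + z^*%R *: delta_mx 0 b.
  by apply/matrixP => i j; rewrite !mxE rmorphD rmorphM /= !rmorph_nat !(andbC (j == _)).
rewrite !mulmxDl !mulmxDr -!scalemxAl -!scalemxAr -!rowE -!colE.
by rewrite !mxE; ring.
Qed.

Lemma positive_op_bounded m (M : 'M[C]_m) (a b : 'I_m) : positive_op M ->
  `|complex.Re (M a b)| <= complex.Re (\tr M) /\
  `|complex.Im (M a b)| <= complex.Re (\tr M).
Proof.
move=> pos.
have q z : 0 <= M a a + z * M a b + z^*%R * (M b a + z * M b b).
  by rewrite -quad_form_delta; exact: pos.
have dge0 e : 0 <= M e e.
  have := pos (delta_mx e 0 + 0 *: delta_mx e 0).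
  by rewrite quad_form_delta conjC0 !mul0r !addr0.
have d (c : 'I_m) : complex.Im (M c c) = 0 /\ 0 <= complex.Re (M c c) <= complex.Re (\tr M).
  have : 0 <= M c c <= \tr M.
    by rewrite dge0 /mxtrace (bigD1 c) //= lerDl sumr_ge0.
  by rewrite !lecE /= => /andP[/andP[/eqP -> ->] /andP[_ ->]].
have [da /andP[a0 a1]] := d a; have [db /andP[b0 b1]] := d b.
have := q 1; have := q (-1); have := q 'i%C; have := q (- 'i%C).
(* The imaginary parts of the four values force M b a to be the conjugate of M a b; the real parts
   then bound twice each component of M a b by M a a + M b b, at most twice the trace. *)
rewrite !lecE; set tr := complex.Re (\tr M) in a1 b1 *.
case: (M a b) (M b a) (M a a) (M b b) da a0 a1 db b0 b1.
move=> x y [x' y'] [u u'] [v v'] /=; simpc => /= -> a0 a1 -> b0 b1.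
move=> /andP[/eqP i1 r1] /andP[/eqP i2 r2] /andP[/eqP i3 r3] /andP[/eqP i4 r4].
by split; rewrite ler_norml; apply/andP; split; lra.
Qed.

Lemma states_bounded m (rho : 'M[C]_m) (a b : 'I_m) : states rho ->
  `|complex.Re (rho a b)| <= 1 /\ `|complex.Im (rho a b)| <= 1.
Proof. by move=> [/(positive_op_bounded a b)] /[swap] ->. Qed.

(** Used where an intensity vanishes: the jump numerator is then 0 as well. *)
Lemma positive_op_tr_eq0 m (M : 'M[C]_m) : positive_op M -> \tr M = 0 -> M = 0.
Proof.
move=> pos tr0; apply/matrixP => a b; rewrite mxE.
have [] := positive_op_bounded a b pos; rewrite tr0 /= !normr_le0.
by case: (M a b) => x y /= /eqP -> /eqP ->.
Qed.

End StatesBounded.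

(** * Compactness of the states and uniform convergence *)

Section UniformConvergence.
Variable R : realType.

(** Flattening a matrix into a row vector turns the box into a product of segments. *)
Lemma compact_mx_box m n (c : R) :
  compact [set M : 'M[R]_(m, n) | forall i j, `|M i j| <= c].
Proof.
pose B := [set v : 'rV[R]_(m * n) | forall i, `[- c, c]%classic (v ord0 i)].
have cB : compact B.
  apply: (@rV_compact _ _ (fun=> `[- c, c]%classic)) => i.
  exact: segment_compact.
rewrite (_ : mkset _ = vec_mx @` B).
  apply: continuous_compact cB; apply: continuous_subspaceT => v.
  apply/(@cvg_mxP R _ (nbhs v) (nbhs_filter v) m n vec_mx) => i j.
  rewrite mxE; under eq_fun do rewrite mxE.
  exact: coord_continuous.
apply/seteqP; split => [M hM|_ [v vB <-] i j].
  exists (mxvec M); last exact: mxvecK.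
  by move=> k; case/mxvec_indexP: k => i j; rewrite mxvecE /= in_itv /= -ler_norml.
by rewrite mxE; have := vB (mxvec_index i j); rewrite /= in_itv /= ler_norml.
Qed.

Variable K : nat.

Definition ofE (x : opE R K) : 'M[R[i]]_K.+1 := \matrix_(a, b) (x.1 a b +i* x.2 a b).

Lemma toEK : cancel (@toE R K) ofE.
Proof. by move=> M; apply/matrixP => a b; rewrite !mxE; case: (M a b). Qed.

Lemma ofEK : cancel ofE (@toE R K).
Proof. by case=> A B; congr (_, _); apply/matrixP => a b; rewrite !mxE. Qed.

(** Over an empty set the supremum would be -oo; the presence of a state makes it nonnegative. *)
Lemma states_nonempty : exists rho : 'M[R[i]]_K.+1, states rho.
Proof.
exists (delta_mx 0 0); split => [u|].
  rewrite -(mul_delta_mx (0 : 'I_1)) mulmxA -mulmxA -rowE -colE.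
  by rewrite mxE big_ord1 !mxE mulrC mul_conjC_ge0.
rewrite -(mul_delta_mx (0 : 'I_1)) mxtrace_mulC mul_delta_mx.
by rewrite /mxtrace big_ord1 mxE.
Qed.

(* Compactness turns uniform convergence on the states into convergence along
   every filter on which the state converges. *)
Lemma unif_cvg_on_statesP (G : nat -> 'M[R[i]]_K.+1 -> R) (G0 : 'M[R[i]]_K.+1 -> R) :
  (forall (F : set_system (opE R K * nat)) (FF : Filter F)
     (rho : opE R K * nat -> 'M[R[i]]_K.+1) (rho0 : 'M[R[i]]_K.+1),
     t.2 @[t --> F] --> \oo -> cvgcm F rho rho0 ->
     (\forall t \near F, states (rho t)) ->
     G t.2 (rho t) - G0 (rho t) @[t --> F] --> (0 : R)) ->
  unif_cvg_on_states G G0.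
Proof.
move=> H.
pose B := [set x : opE R K |
  (forall i j, `|x.1 i j| <= 1) /\ forall i j, `|x.2 i j| <= 1].
(* The box contains every state. In near-covering form, ranks that work near each of its points
   yield one rank for the whole box. *)
have /compact_near_coveringP/near_covering_withinP cB : compact B.
  have c1 := @compact_mx_box K.+1 K.+1 1; exact: (compact_setX c1 c1).
have [rho1 rho1S] := states_nonempty.
pose s n := ereal_sup [set `|G n rho - G0 rho|%:E | rho in @states R K.+1].
have near_small (e : R) : 0 < e -> \forall n \near \oo,
    forall rho, states rho -> `|G n rho - G0 rho| < e.
  move=> e0.
  have /cB : forall x, B x -> \forall x' \near x & n \near \oo, B x' ->
      states (ofE x') -> `|G n (ofE x') - G0 (ofE x')| < e.
    move=> x Bx; pose D (t : opE R K * nat) := states (ofE t.1).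
    (* Pairs close to (x, oo) whose first component is a state. Where no state is close to [x] this
       filter is degenerate, so [H] has to cover filters that are not proper. *)
    pose F := within D (filter_prod (nbhs x) \oo).
    have FF : Filter F by exact: within_filter.
    have Fprod : F --> filter_prod (nbhs x) \oo by exact: cvg_within.
    have h1 : t.1 @[t --> F] --> x by exact: cvg_trans (cvg_app fst Fprod) cvg_fst.
    have h2 : t.2 @[t --> F] --> \oo by exact: cvg_trans (cvg_app snd Fprod) cvg_snd.
    have h3 : cvgcm F (fun t => ofE t.1) (ofE x).
      by apply/cvg_toEP; rewrite ofEK; under eq_fun do rewrite ofEK.
    have h4 : \forall t \near F, states (ofE t.1).
      by change (filter_prod (nbhs x) \oo (fun t => D t -> D t)); exact: filterE.
    have /cvgrPdist_lt/(_ e e0) h5 := H F FF _ _ h2 h3 h4.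
    apply: (@filterS _ (filter_prod (nbhs x) \oo) _ _ _ _ h5) => t h _ Dt.
    by have := h Dt; rewrite sub0r normrN.
  move=> h; near=> n => rho rhoS; rewrite -(toEK rho).
  have rB : B (toE rho).
    by split => i j; rewrite mxE; have [] := states_bounded i j rhoS.
  apply: (near h n _ (toE rho)) => //; by rewrite toEK.
have s_ge0 n : (0 <= s n)%E.
  apply: (@le_trans _ _ `|G n rho1 - G0 rho1|%:E); first by rewrite lee_fin.
  by apply: ereal_sup_ubound; exists rho1.
have s_le (e : R) : 0 < e -> \forall n \near \oo, (s n <= e%:E)%E.
  move=> e0; near=> n; apply: ge_ereal_sup => _ [rho rhoS <-].
  by rewrite lee_fin ltW //; apply: (near (near_small _ e0) n).
apply/fine_cvgP; split.
  near=> n; rewrite fin_numE -ltey -ltNye (lt_le_trans _ (s_ge0 n)) ?ltNyr //=.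
  by apply: (@le_lt_trans _ _ 1%:E) (ltry _); near: n; exact: s_le.
apply/cvgrPdist_le => e e0; near=> n; rewrite sub0r normrN /=.
have sn : (s n <= e%:E)%E by near: n; exact: s_le.
rewrite ger0_norm; last by apply: fine_ge0; exact: s_ge0.
rewrite -lee_fin fineK //; rewrite fin_numE -ltey -ltNye.
by rewrite (lt_le_trans _ (s_ge0 n)) ?ltNyr //= (le_lt_trans sn) ?ltry.
Unshelve. all: by end_near. Qed.

End UniformConvergence.

(** * Real scalars and the bookkeeping of powers of sqrt(n) *)

Section RealScaling.
Variables (R : realType) (K : nat).
Local Notation C := R[i].
Implicit Types M : 'M[C]_K.+1.

Lemma toED M M' : toE (M + M') = toE M + toE M'.
Proof. by congr (_, _); apply/matrixP => a b; rewrite !mxE ?ReD ?ImD. Qed.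

Lemma toEN M : toE (- M) = - toE M.
Proof. by congr (_, _); apply/matrixP => a b; rewrite !mxE ?ReN ?ImN. Qed.

Lemma toEZ (x : R) M : toE (x%:C *: M) = x *: toE M.
Proof.
by congr (_, _); apply/matrixP => a b; rewrite !mxE ?ReM ?ImM /= mul0r ?subr0 ?addr0.
Qed.

Lemma toE_sum (I : Type) (r : seq I) (Q : pred I) (M : I -> 'M[C]_K.+1) :
  toE (\sum_(i <- r | Q i) M i) = \sum_(i <- r | Q i) toE (M i).
Proof.
apply: (big_morph _ toED).
by rewrite -(subrr (0 : 'M[C]_K.+1)) toED toEN subrr.
Qed.

Lemma trmxC_scale (x : R) m n (M : 'M[C]_(m, n)) :
  (x%:C *: M)^t* = x%:C *: M^t*.
Proof.
by apply/matrixP => a b; rewrite !mxE rmorphM /=; congr (_ * _); exact: conjc_real.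
Qed.

Lemma scale_sandwich (x : R) m n (M M' : 'M[C]_(m, n)) (S : 'M[C]_n) :
  (x%:C *: M) *m S *m (x%:C *: M')^t* = (x ^+ 2)%:C *: (M *m S *m M'^t*).
Proof.
rewrite trmxC_scale -!scalemxAl -scalemxAr scalerA; congr (_ *: _).
by rewrite -rmorphM.
Qed.

End RealScaling.

Lemma sum_split_ord0 (W : zmodType) n (g : 'I_n.+1 -> 'I_n.+1 -> W) :
  \sum_k \sum_l g k l = g ord0 ord0
    + \sum_(k | k != ord0) (g k ord0 + g ord0 k)
    + \sum_(k | k != ord0) \sum_(l | l != ord0) g k l.
Proof.
rewrite [LHS](bigD1 ord0) //= [in X in X + _](bigD1 ord0) //=.
have -> : \sum_(k | k != ord0) \sum_l g k l = \sum_(k | k != ord0)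
    (g k ord0 + \sum_(l | l != ord0) g k l).
  by apply: eq_bigr => k _; rewrite (bigD1 ord0).
by rewrite !big_split /= !addrA; congr (_ + _); rewrite addrAC.
Qed.

(** With [x] = sqrt(n), the powers are distributed so that each scaled block is one whose limit is
    known. *)
Lemma scale_sum_split (Q : fieldType) (W : lmodType Q) n (c : 'I_n.+1 -> 'I_n.+1 -> Q)
    (g : 'I_n.+1 -> 'I_n.+1 -> W) (S : W) (x : Q) : x != 0 ->
  x *: (\sum_k \sum_l c k l *: g k l - c ord0 ord0 *: S) =
  x^-1 *: (c ord0 ord0 *: (x ^+ 2 *: (g ord0 ord0 - S)))
  + \sum_(k | k != ord0) (c k ord0 *: (x *: g k ord0) + c ord0 k *: (x *: g ord0 k))
  + x^-1 *: \sum_(k | k != ord0) \sum_(l | l != ord0) c k l *: (x ^+ 2 *: g k l).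
Proof.
move=> x0; have xx (w : W) : x^-1 *: (x ^+ 2 *: w) = x *: w.
  by rewrite scalerA expr2 mulrA mulVf ?mul1r.
rewrite sum_split_ord0 [in LHS]addrAC [in X in _ *: (X + _)]addrAC -scalerBr.
rewrite !scalerDr; congr (_ + _ + _).
- rewrite -!scalerDr [RHS]scalerA mulrC -scalerA xx !scalerA.
  by rewrite mulrC.
- rewrite scaler_sumr; apply: eq_bigr => k _; rewrite scalerDr !scalerA.
  by rewrite ![x * _]mulrC.
rewrite !scaler_sumr; apply: eq_bigr => k _; rewrite !scaler_sumr; apply: eq_bigr => l _.
by rewrite [RHS]scalerA mulrC -scalerA xx !scalerA mulrC.
Qed.

(** With [x] = sqrt(n) and [q] the probability of the outcome, the state moves by W / (x q): the
    first-order terms cancel, and the second-order term keeps the factor n q / (x q)^2 = 1 / q. *)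
Lemma taylor_rescale (Q : realFieldType) (x q y d1 d2 : Q) : x != 0 -> q != 0 ->
  x ^+ 2 * ((y + x^-1 / q * d1 + 2^-1 * ((x^-1 / q) ^+ 2 * d2) - y) * q) - x * d1 =
  2^-1 * (q^-1 * d2).
Proof. by move=> x0 q0; field; rewrite ?x0 ?q0. Qed.

(** * Positivity of the outcomes and of the jump numerators *)

Section KrausPositivity.
Variables (R : realType) (K N p : nat).
Local Notation C := R[i].
Variables (X : 'I_N.+1 -> 'cV[C]_N.+1) (P : 'I_p.+1 -> 'M[C]_N.+1)
  (A : 'M[C]_N.+1) (lambda : 'I_p.+1 -> R).
Hypothesis hP : spectral_decomposition A lambda P.

Lemma positive_op_sum (I : finType) m (M : I -> 'M[C]_m) :
  (forall i, positive_op (M i)) -> positive_op (\sum_i M i).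
Proof.
move=> h u; rewrite mulmx_sumr mulmx_suml summxE.
by apply: sumr_ge0 => i _; exact: h.
Qed.

Lemma sandwich_ge0 (V : 'I_N.+1 -> 'M[C]_K.+1) i rho :
  positive_op rho -> positive_op (sandwich X P V i rho).
Proof.
move=> h; rewrite (sandwichE X hP); apply: positive_op_sum => c.
exact: positive_op_conj.
Qed.

Lemma jump_num_ge0 (L : 'I_N.+1 -> 'M[C]_K.+1) i rho :
  positive_op rho -> positive_op (jump_num X P L i rho).
Proof.
(* Erasing the operator of index 0 turns the numerator into a full [sandwich], positive by its Kraus
   form. *)
move=> h; pose L' k := if k == ord0 then 0 else L k.
suff -> : jump_num X P L i rho = sandwich X P L' i rho by exact: sandwich_ge0.
rewrite /sandwich sum_split_ord0 /L' eqxx !mul0mx scaler0 add0r.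
rewrite [X in X + _]big1 => [|k _]; last first.
  by rewrite trmx0 map_mx0 mulmx0 !mul0mx !scaler0 addr0.
rewrite add0r; apply: eq_bigr => k /negbTE ->; apply: eq_bigr => l /negbTE ->.
by [].
Qed.

Lemma ge0_Re (x : C) : 0 <= x -> (complex.Re x)%:C = x.
Proof. by rewrite lecE; case: x => a b /= /andP[/eqP -> _]. Qed.

End KrausPositivity.

(** * Limit of the discrete generator along a filter *)

Section OneStepLimit.
Variables (R : realType) (K N p : nat).
Local Notation C := R[i].
Local Notation op0 := 'M[C]_K.+1.
Variables (X : 'I_N.+1 -> 'cV[C]_N.+1) (P : 'I_p.+1 -> 'M[C]_N.+1)
  (A : 'M[C]_N.+1) (lambda : 'I_p.+1 -> R) (L : 'I_N.+1 -> op0).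
Hypothesis hX : orthonormal_basis X.
Hypothesis hP : spectral_decomposition A lambda P.
Variables (f : opE R K -> R).
Hypothesis fC2 : C2c f.
Variables (T : Type) (F : set_system T).
Context {FF : Filter F}.
(* r stands for sqrt(n), so that n = r ^+ 2, and V k for the block U_k0(n). *)
Variables (r : T -> R) (V : T -> 'I_N.+1 -> op0) (rho : T -> op0) (rho0 : op0).
Hypothesis r_gt0 : \forall t \near F, 0 < r t.
Hypothesis rV_cvg0 : (r t)^-1 @[t --> F] --> (0 : R).
Hypothesis V0_cvg : cvgcm F (fun t => (r t ^+ 2)%:C *: (V t ord0 - 1%:M)) (L ord0).
Hypothesis V_cvg : forall k, k != ord0 -> cvgcm F (fun t => (r t)%:C *: V t k) (L k).
Hypothesis rho_cvg : cvgcm F rho rho0.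
Hypothesis rho_states : \forall t \near F, states (rho t).

Local Notation Nm t i := (sandwich X P (V t) i (rho t)).

(** V_0 = 1 + n^-1 (n (V_0 - 1)), where n (V_0 - 1) converges. *)
Lemma cvg_V0 : cvgcm F (V ^~ ord0) 1%:M.
Proof.
have h : cvgcm F (fun t => 1%:M + ((r t)^-1 ^+ 2)%:C *:
    ((r t ^+ 2)%:C *: (V t ord0 - 1%:M))) (1%:M + (0 ^+ 2)%:C *: L ord0).
  apply: cvgcmD; first exact: cvgcm_cst.
  apply: cvgcmZ V0_cvg; apply: cvgc_real.
  by under eq_fun do rewrite expr2; rewrite expr2; exact: cvgM.
rewrite expr0n /= scale0r addr0 in h; apply: near_eq_cvgcm h.
near=> t; rewrite scalerA -rmorphM -exprMn mulVf; last first.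
  by rewrite gt_eqF //; near: t.
by rewrite expr1n scale1r addrC subrK.
Unshelve. all: by end_near. Qed.

(** From V_0 rho V_0^* - rho = (V_0 - 1) rho V_0^* + rho (V_0 - 1)^*. *)
Lemma cvg_V0_conj :
  cvgcm F (fun t => (r t ^+ 2)%:C *: (V t ord0 *m rho t *m (V t ord0)^t* - rho t))
    (L ord0 *m rho0 + rho0 *m (L ord0)^t*).
Proof.
have h : cvgcm F (fun t => ((r t ^+ 2)%:C *: (V t ord0 - 1%:M)) *m rho t *m (V t ord0)^t*
    + rho t *m ((r t ^+ 2)%:C *: (V t ord0 - 1%:M))^t*)
    (L ord0 *m rho0 *m (1%:M)^t* + rho0 *m (L ord0)^t*).
  apply: cvgcmD; apply: cvgcmM => //; last exact: cvgcm_trmxC.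
  - exact: cvgcmM.
  - by apply: cvgcm_trmxC; exact: cvg_V0.
rewrite trmx1 map_mx1 mulmx1 in h; apply: near_eq_cvgcm h; apply: filterE => t.
rewrite trmxC_scale -!scalemxAl -scalemxAr -scalerDr; congr (_ *: _).
rewrite linearB /= map_mxB trmx1 map_mx1 !mulmxBl !mulmxBr mul1mx mulmx1.
by rewrite addrA subrK.
Qed.

Lemma cvg_cross (k l : 'I_N.+1) : k != ord0 -> l != ord0 ->
  cvgcm F (fun t => (r t ^+ 2)%:C *: (V t k *m rho t *m (V t l)^t*))
    (L k *m rho0 *m (L l)^t*).
Proof.
move=> k0 l0; under eq_fun do rewrite -scale_sandwich.
apply: cvgcmM; last by apply: cvgcm_trmxC; exact: V_cvg.
by apply: cvgcmM rho_cvg; exact: V_cvg.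
Qed.

Lemma cvg_drift :
  cvgcm F (fun t => (r t ^+ 2)%:C *: (\sum_k V t k *m rho t *m (V t k)^t* - rho t))
    (drift L rho0).
Proof.
have h : cvgcm F (fun t =>
    (r t ^+ 2)%:C *: (V t ord0 *m rho t *m (V t ord0)^t* - rho t)
    + \sum_(k | k != ord0) (r t ^+ 2)%:C *: (V t k *m rho t *m (V t k)^t*))
    (drift L rho0).
  apply: cvgcmD; first exact: cvg_V0_conj.
  by apply: cvgcm_sum => k k0; exact: cvg_cross.
apply: near_eq_cvgcm h; apply: filterE => t.
rewrite -scaler_sumr -scalerDr; congr (_ *: _).
by rewrite [in RHS](bigD1 ord0) //= addrAC.
Qed.

(** All p^i_0l and p^i_k0 vanish along with p^i_00, so only products of two blocks of order
    1/sqrt(n) remain. *)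
Lemma cvg_jump_num i : pcoef X P i ord0 ord0 = 0 ->
  cvgcm F (fun t => (r t ^+ 2)%:C *: Nm t i) (jump_num X P L i rho0).
Proof.
move=> p0.
have h : cvgcm F (fun t => \sum_(k | k != ord0) \sum_(l | l != ord0)
    pcoef X P i k l *: ((r t ^+ 2)%:C *: (V t k *m rho t *m (V t l)^t*)))
    (jump_num X P L i rho0).
  apply: cvgcm_sum => k k0; apply: cvgcm_sum => l l0.
  by apply: cvgcmZ; [exact: cvgc_cst|exact: cvg_cross].
apply: near_eq_cvgcm h; apply: filterE => t.
rewrite /sandwich [in RHS](bigD1 ord0) //= [X in _ *: (X + _)]big1 ?add0r.
  rewrite scaler_sumr; apply: eq_bigr => k k0; rewrite [in RHS](bigD1 ord0) //=.
  have [_ ->] := pcoef_eq0 hP k p0; rewrite scale0r add0r scaler_sumr.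
  by apply: eq_bigr => l l0; rewrite !scalerA mulrC.
by move=> l _; have [-> _] := pcoef_eq0 hP l p0; rewrite scale0r.
Qed.

Lemma cvg_cross0 k : k != ord0 ->
  cvgcm F (fun t => (r t)%:C *: (V t k *m rho t *m (V t ord0)^t*)) (L k *m rho0) /\
  cvgcm F (fun t => (r t)%:C *: (V t ord0 *m rho t *m (V t k)^t*)) (rho0 *m (L k)^t*).
Proof.
move=> k0; have c1 := cvg_V0; have ck := V_cvg k0.
have cT : cvgcm F (fun t => (V t ord0)^t*) 1%:M.
  by rewrite -(map_mx1 (Num.conj : {rmorphism C -> C})) -trmx1; exact: cvgcm_trmxC.
have ckT : cvgcm F (fun t => ((r t)%:C *: V t k)^t*) ((L k)^t*) by exact: cvgcm_trmxC.
split.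
  rewrite -[L k *m rho0]mulmx1; under eq_fun do rewrite 2!scalemxAl.
  exact: (cvgcmM (cvgcmM ck rho_cvg) cT).
rewrite -[rho0]mul1mx; under eq_fun do rewrite scalemxAr -trmxC_scale.
exact: (cvgcmM (cvgcmM c1 rho_cvg) ckT).
Qed.

Lemma cvg_diff_num i :
  cvgcm F (fun t => (r t)%:C *: (Nm t i - pcoef X P i ord0 ord0 *: rho t))
    (diff_num X P L i rho0).
Proof.
(* Of the three groups in [scale_sum_split], [h1] and [h3] carry a factor 1/sqrt(n) and vanish; the
   cross terms [h2] give the limit. *)
have cr : cvgc F (fun t => ((r t)^-1)%:C) 0 by exact: cvgc_real.
have h1 : cvgcm F (fun t => ((r t)^-1)%:C *: (pcoef X P i ord0 ord0 *:
      ((r t ^+ 2)%:C *: (V t ord0 *m rho t *m (V t ord0)^t* - rho t)))) 0.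
  apply: cvgcmZ0 cr _; apply: cvgcmZ cvg_V0_conj; exact: cvgc_cst.
have h2 : cvgcm F (fun t => \sum_(k | k != ord0)
    (pcoef X P i k ord0 *: ((r t)%:C *: (V t k *m rho t *m (V t ord0)^t*))
     + pcoef X P i ord0 k *: ((r t)%:C *: (V t ord0 *m rho t *m (V t k)^t*))))
    (diff_num X P L i rho0).
  apply: cvgcm_sum => k k0; have [c1 c2] := cvg_cross0 k0.
  by apply: cvgcmD; apply: cvgcmZ => //; exact: cvgc_cst.
have h3 : cvgcm F (fun t => ((r t)^-1)%:C *: \sum_(k | k != ord0) \sum_(l | l != ord0)
    pcoef X P i k l *: ((r t ^+ 2)%:C *: (V t k *m rho t *m (V t l)^t*))) 0.
  have cJ : cvgcm F (fun t => \sum_(k | k != ord0) \sum_(l | l != ord0)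
    pcoef X P i k l *: ((r t ^+ 2)%:C *: (V t k *m rho t *m (V t l)^t*)))
    (jump_num X P L i rho0).
    apply: cvgcm_sum => k k0; apply: cvgcm_sum => l l0.
    by apply: cvgcmZ; [exact: cvgc_cst|exact: cvg_cross].
  exact: cvgcmZ0 cr cJ.
rewrite -[diff_num _ _ _ _ _]add0r -[0 + _]addr0.
apply: near_eq_cvgcm (cvgcmD (cvgcmD h1 h2) h3); near=> t.
have rt0 : (r t)%:C != 0 :> C.
  by rewrite eq_complex /= eqxx andbT gt_eqF //; near: t.
rewrite fmorphV rmorphXn; symmetry.
exact: (scale_sum_split (pcoef X P i)
  (fun k l => V t k *m rho t *m (V t l)^t*) (rho t) rt0).
Unshelve. all: by end_near. Qed.

(* With J = v_i(S) (g_i(S) + S) and Tr J = v_i(S), this is the i-th term of the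
   jump part at the state S; it makes sense, and is continuous, also when v_i
   vanishes, as f is bounded. *)
Definition jump_term (J S : op0) : R :=
  (f (toE ((\tr J)^-1 *: J)) - f (toE S)) * complex.Re (\tr J)
  - D1 f (toE S) (toE (J - \tr J *: S)).

Lemma cvg_jump_term (J S : T -> op0) (J0 S0 : op0) :
  cvgcm F J J0 -> cvgcm F S S0 ->
  jump_term (J t) (S t) @[t --> F] --> jump_term J0 S0.
Proof.
move=> cJ cS; have ctr : cvgc F (fun t => \tr (J t)) (\tr J0) by exact: cvgcm_tr.
have cSE : toE (S t) @[t --> F] --> toE S0 by exact/cvg_toEP.
apply: cvgB; last first.
  apply: (cvg_D1 fC2 cSE); apply/cvg_toEP.
  exact: (cvgcmD cJ (cvgcmN (cvgcmZ ctr cS))).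
have cf (Y : T -> opE R K) (Y0 : opE R K) :
    Y t @[t --> F] --> Y0 -> f (Y t) @[t --> F] --> f Y0.
  by move=> cY; apply: cvg_comp cY _; exact: C2c_continuous.
(* If the limiting trace is 0, the normalised operator may fail to converge, but [f] is bounded and
   multiplied by a trace that tends to 0. *)
have [tr0|trN0] := eqVneq (\tr J0) 0; last first.
  apply: cvgM; last exact: ctr.1.
  apply: cvgB; last exact: cf.
  by apply: cf; apply/cvg_toEP; apply: cvgcmZ => //; exact: cvgcV.
have [B fB] := C2c_bounded fC2; have [ctrR _] := ctr.
rewrite tr0 mulr0; rewrite tr0 in ctrR.
have h : (B + B) * `|complex.Re (\tr (J t))| @[t --> F] --> (0 : R).
  rewrite -(mulr0 (B + B)) -(@normr0 _ R); apply: cvgM; first exact: cvg_cst.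
  exact: cvg_norm ctrR.
apply/norm_cvg0P; apply: squeeze_cvgr (cvg_cst 0) h.
apply: filterE => t; rewrite normr_ge0 /= normrM ler_wpM2r //.
by apply: le_trans (ler_normB _ _) _; apply: lerD.
Qed.

(** If p^i_00 <> 0, the subtracted term may be of order sqrt(n); only the sum of these terms over
    all outcomes has a limit. *)
Definition step_term (t : T) (i : 'I_p.+1) : R :=
  r t ^+ 2 * ((f (toE ((\tr (Nm t i))^-1 *: Nm t i)) - f (toE (rho t)))
              * complex.Re (\tr (Nm t i)))
  - D1 f (toE (rho t)) (toE ((r t ^+ 2)%:C *: (Nm t i - \tr (Nm t i) *: rho t))).

(** [jump_term] is homogeneous in its first argument, so the step is [jump_term] at n N_i, whose
    limit is the jump numerator. *)
Lemma cvg_step_jump i : pcoef X P i ord0 ord0 = 0 ->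
  step_term t i @[t --> F] --> jump_term (jump_num X P L i rho0) rho0.
Proof.
move=> p0; have := cvg_jump_term (cvg_jump_num p0) rho_cvg.
apply: cvg_trans; apply: near_eq_cvg; near=> t.
have rt0 : (r t ^+ 2)%:C != 0 :> C.
  by rewrite eq_complex /= eqxx andbT gt_eqF // exprn_gt0 //; near: t.
rewrite /jump_term /step_term mxtraceZ invfM scalerA mulrAC mulVf // mul1r.
rewrite scalerBr -scalerA ReM /= mul0r subr0.
by rewrite mulrCA.
Unshelve. all: by end_near. Qed.

Lemma linear_scale (g : opE R K -> R) a u : linear (g : _ -> R^o) ->
  g (a *: u) = a * g u.
Proof. by move=> /GRing.scalable_linear ->. Qed.

Lemma D2_scale x a u : D2 f x (a *: u) (a *: u) = a ^+ 2 * D2 f x u u.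
Proof.
rewrite (linear_scale _ _ (D2_linearr fC2 x _)).
by rewrite (linear_scale _ _ (D2_linearl f x u)) expr2 mulrA.
Qed.

(** p^i_00 is a nonnegative real, hence so is its complex square root, and real factors pass through
    [toE]. *)
Lemma diff_coefE i S : exists2 a : R, a ^+ 2 = (complex.Re (pcoef X P i ord0 ord0))^-1
  & diff_coef X P L i S = a%:C *: (diff_num X P L i S - \tr (diff_num X P L i S) *: S).
Proof.
have p0 := pcoef_ge0 X hP i ord0; rewrite /diff_coef.
set q := pcoef X P i ord0 ord0 in p0 *.
have s0 : 0 <= sqrtC q by rewrite sqrtC_ge0.
exists (complex.Re (sqrtC q))^-1; last first.
  by rewrite fmorphV /= (ge0_Re s0).
rewrite exprVn; congr (_^-1); apply: (@complexI R).
by rewrite rmorphXn /= (ge0_Re s0) (ge0_Re p0) sqrtCK.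
Qed.

(** The outcome moves the state by W / (sqrt(n) q), where [W] converges and [q] tends to p^i_00;
    Taylor's formula leaves D^2 f(W, W) / (2 q) at an intermediate point. *)
Lemma cvg_step_diffusive i : pcoef X P i ord0 ord0 != 0 ->
  step_term t i @[t --> F] --> 2^-1 * D2 f (toE rho0)
    (toE (diff_coef X P L i rho0)) (toE (diff_coef X P L i rho0)).
Proof.
move=> p0; pose p00 := pcoef X P i ord0 ord0.
pose Z t := (r t)%:C *: (Nm t i - p00 *: rho t).
have cZ : cvgcm F Z (diff_num X P L i rho0) by exact: cvg_diff_num.
pose W t := Z t - \tr (Z t) *: rho t.
pose W0 := diff_num X P L i rho0 - \tr (diff_num X P L i rho0) *: rho0.
have cW : cvgcm F W W0.
  by apply: cvgcmD => //; apply: cvgcmN; apply: cvgcmZ => //; exact: cvgcm_tr.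
have cWE : toE (W t) @[t --> F] --> toE W0 by exact/cvg_toEP.
pose q t := complex.Re (\tr (Nm t i)).
(* As Tr rho = 1, Tr N_i = p^i_00 + Tr Z / sqrt(n). *)
have cq : q t @[t --> F] --> complex.Re p00.
  have h : cvgc F (fun t => p00 + ((r t)^-1)%:C * \tr (Z t))
      (p00 + 0%:C * \tr (diff_num X P L i rho0)).
    apply: cvgcD; first exact: cvgc_cst.
    by apply: cvgcM; [exact: cvgc_real|exact: cvgcm_tr].
  have {h} [h _] := h; rewrite mul0r addr0 in h.
  apply: cvg_trans h; apply: near_eq_cvg; near=> t.
  have rt0 : (r t)%:C != 0 :> C.
    by rewrite eq_complex /= eqxx andbT gt_eqF //; near: t.
  have [_ tr1] : states (rho t) by near: t.
  rewrite /Z mxtraceZ mulrA -rmorphM mulVf; last first.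
    by apply: contra rt0 => /eqP ->.
  by rewrite mul1r linearB linearZ /= tr1 mulr1 addrC subrK.
have q0 : 0 < complex.Re p00.
  have pge0 : 0 <= p00 := pcoef_ge0 X hP i ord0.
  move: pge0 p0; rewrite -/p00 lecE eq_complex /= => /andP[/eqP -> Re_ge0].
  by rewrite eqxx andbT lt_neqAle eq_sym Re_ge0 andbT.
have q_gt0 : \forall t \near F, 0 < q t by exact: (cvgr_gt _ cq).
have cqV : (q t)^-1 @[t --> F] --> (complex.Re p00)^-1.
  by apply: cvgV => //; rewrite gt_eqF.
(* Taylor's intermediate parameters are chosen for all [t] at once. They need not converge, but
   being in ]0, 1[ they leave the vanishing increment small. *)
have /choice[c hc] : forall t, exists c : R, 0 < c < 1 /\
    f (toE (rho t) + ((r t)^-1 / q t) *: toE (W t)) = f (toE (rho t))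
      + D1 f (toE (rho t)) (((r t)^-1 / q t) *: toE (W t))
      + 2^-1 * D2 f (toE (rho t) + c *: (((r t)^-1 / q t) *: toE (W t)))
          (((r t)^-1 / q t) *: toE (W t)) (((r t)^-1 / q t) *: toE (W t)).
  move=> t; set w := _ *: toE (W t).
  by have [c c01 e] := C2c_taylor fC2 (toE (rho t)) w; exists c.
pose xi t := toE (rho t) + c t *: (((r t)^-1 / q t) *: toE (W t)).
have cxi : xi t @[t --> F] --> toE rho0.
  rewrite -[X in _ --> X]addr0; apply: cvgD; first exact/cvg_toEP.
  rewrite -(scale0r (toE W0)); under eq_fun do rewrite scalerA.
  apply: cvgZ => //.
  have h : (r t)^-1 / q t @[t --> F] --> (0 : R).
    by rewrite -(mul0r (complex.Re p00)^-1); exact: cvgM.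
  have hn : `|(r t)^-1 / q t| @[t --> F] --> (0 : R).
    by rewrite -(@normr0 _ R); exact: cvg_norm h.
  apply/norm_cvg0P; apply: squeeze_cvgr (cvg_cst 0) hn.
  apply: filterE => t; rewrite normr_ge0 /= normrM ler_piMl //.
  by have [/andP[c0 c1] _] := hc t; rewrite ger0_norm ltW.
have h : 2^-1 * ((q t)^-1 * D2 f (xi t) (toE (W t)) (toE (W t))) @[t --> F] -->
    2^-1 * ((complex.Re p00)^-1 * D2 f (toE rho0) (toE W0) (toE W0)).
  by apply: cvgM; [exact: cvg_cst|apply: cvgM => //; exact: cvg_D2].
have [a a2 ->] := diff_coefE i rho0; rewrite -/W0 toEZ D2_scale a2 -/p00.
apply: cvg_trans h; apply: near_eq_cvg; near=> t.
have rt0 : 0 < r t by near: t.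
have qt0 : 0 < q t by near: t.
have [pos tr1] : states (rho t) by near: t.
have trN : \tr (Nm t i) = (q t)%:C.
  by rewrite ge0_Re //; apply: positive_op_tr; exact: (sandwich_ge0 X hP).
have WE : W t = (r t)%:C *: (Nm t i - \tr (Nm t i) *: rho t).
  rewrite /W /Z mxtraceZ [\tr (_ - _)]raddfB /= mxtraceZ tr1 mulr1 -scalerA -scalerBr.
  by rewrite scalerBl opprB addrA subrK.
have NE : toE ((\tr (Nm t i))^-1 *: Nm t i) =
    toE (rho t) + ((r t)^-1 / q t) *: toE (W t).
  rewrite -toEZ -toED; congr toE.
  rewrite WE scalerA -rmorphM mulrAC mulVf ?gt_eqF // mul1r trN -fmorphV scalerBr.
  by rewrite scalerA -rmorphM mulVf ?gt_eqF // scale1r addrC subrK.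
rewrite /step_term NE (hc t).2 -/(xi t) -/(q t) D2_scale.
rewrite (linear_scale _ _ (D1_linear f _)).
have -> : toE ((r t ^+ 2)%:C *: (Nm t i - \tr (Nm t i) *: rho t)) = r t *: toE (W t).
  by rewrite WE -toEZ scalerA -rmorphM expr2.
rewrite (linear_scale _ _ (D1_linear f _)).
by symmetry; apply: taylor_rescale; rewrite gt_eqF.
Unshelve. all: by end_near. Qed.

Hypothesis total : \forall t \near F, \sum_i \tr (Nm t i) = 1.

Lemma D1_sum (I : finType) x (u : I -> opE R K) :
  D1 f x (\sum_i u i) = \sum_i D1 f x (u i).
Proof. by rewrite /D1 linear_sum. Qed.

(** As sum_i N_i = sum_k V_k rho V_k^* and the traces add up to 1, the subtracted terms recombine
    into the drift expression. *)
Lemma step_sum : \forall t \near F,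
  r t ^+ 2 * (\sum_i (f (toE ((\tr (Nm t i))^-1 *: Nm t i)) - f (toE (rho t)))
              * complex.Re (\tr (Nm t i))) =
  \sum_i step_term t i
  + D1 f (toE (rho t)) (toE ((r t ^+ 2)%:C *:
      (\sum_k V t k *m rho t *m (V t k)^t* - rho t))).
Proof.
near=> t; rewrite /step_term sumrB -mulr_sumr -D1_sum -toE_sum.
rewrite -scaler_sumr sumrB -scaler_suml (sum_sandwich hX hP).
have -> : \sum_i \tr (Nm t i) = 1 by near: t.
by rewrite scale1r subrK.
Unshelve. all: by end_near. Qed.

(** A common form of both limits. Written with [jump_term], it stays continuous where an intensity
    vanishes. *)
Definition limit_gen (S : op0) : R :=
  \sum_i (if pcoef X P i ord0 ord0 == 0 then jump_term (jump_num X P L i S) S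
          else 2^-1 * D2 f (toE S) (toE (diff_coef X P L i S)) (toE (diff_coef X P L i S)))
  + D1 f (toE S) (toE (drift L S)).

Lemma cvg_step :
  r t ^+ 2 * (\sum_i (f (toE ((\tr (Nm t i))^-1 *: Nm t i)) - f (toE (rho t)))
              * complex.Re (\tr (Nm t i))) @[t --> F] --> limit_gen rho0.
Proof.
have h : \sum_i step_term t i
  + D1 f (toE (rho t)) (toE ((r t ^+ 2)%:C *:
      (\sum_k V t k *m rho t *m (V t k)^t* - rho t)))
  @[t --> F] --> limit_gen rho0.
  apply: cvgD; last first.
    by apply: (cvg_D1 fC2); apply/cvg_toEP => //; exact: cvg_drift.
  apply: cvgr_sum => i _; case: eqP => [|/eqP] hi; first exact: cvg_step_jump.
  exact: cvg_step_diffusive.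
apply: cvg_trans h; apply: near_eq_cvg; apply: filterS step_sum => t.
by move=> ->.
Qed.

(** Uniform convergence compares the generators at the moving state, so the limit generator must be
    continuous along it. *)
Lemma cvg_limit_gen : limit_gen (rho t) @[t --> F] --> limit_gen rho0.
Proof.
have cL k : cvgcm F (fun=> L k) (L k) by exact: cvgcm_cst.
have cLT k : cvgcm F (fun=> (L k)^t*) ((L k)^t*) by exact: cvgcm_cst.
have cJ i : cvgcm F (fun t => jump_num X P L i (rho t)) (jump_num X P L i rho0).
  apply: cvgcm_sum => k _; apply: cvgcm_sum => l _; apply: cvgcmZ.
    exact: cvgc_cst.
  by apply: cvgcmM => //; exact: cvgcmM.
have cD i : cvgcm F (fun t => diff_num X P L i (rho t)) (diff_num X P L i rho0).
  apply: cvgcm_sum => k _; apply: cvgcmD; apply: cvgcmZ; try exact: cvgc_cst.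
    exact: cvgcmM.
  exact: cvgcmM.
have cE : toE (rho t) @[t --> F] --> toE rho0 by exact/cvg_toEP.
apply: cvgD.
  apply: cvgr_sum => i _.
  case: (pcoef X P i ord0 ord0 == 0); first exact: (cvg_jump_term (cJ i) rho_cvg).
  apply: cvgM; first exact: cvg_cst.
  have c : toE (diff_coef X P L i (rho t)) @[t --> F] --> toE (diff_coef X P L i rho0).
    apply/cvg_toEP; apply: cvgcmZ; first exact: cvgc_cst.
    by apply: cvgcmD => //; apply: cvgcmN; apply: cvgcmZ => //; exact: cvgcm_tr.
  exact: cvg_D2.
apply: (cvg_D1 fC2 cE); apply/cvg_toEP; apply: cvgcmD; last first.
  by apply: cvgcm_sum => k _; apply: cvgcmM => //; exact: cvgcmM.
by apply: cvgcmD; exact: cvgcmM.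
Qed.

Lemma cvg_step_sub :
  r t ^+ 2 * (\sum_i (f (toE ((\tr (Nm t i))^-1 *: Nm t i)) - f (toE (rho t)))
              * complex.Re (\tr (Nm t i))) - limit_gen (rho t) @[t --> F] --> (0 : R).
Proof.
rewrite -[X in _ --> X](subrr (limit_gen rho0)).
exact: (cvgB cvg_step cvg_limit_gen).
Qed.

End OneStepLimit.

(** * Identification of the generators of the statement *)

Section GeneratorFormulas.
Variables (R : realType) (K N p : nat).
Local Notation C := R[i].
Variables (X : 'I_N.+1 -> 'cV[C]_N.+1) (P : 'I_p.+1 -> 'M[C]_N.+1)
  (A : 'M[C]_N.+1) (lambda : 'I_p.+1 -> R) (L : 'I_N.+1 -> 'M[C]_K.+1).
Hypothesis hX : orthonormal_basis X.
Hypothesis hP : spectral_decomposition A lambda P.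
Hypothesis hp0 : pcoef X P ord0 ord0 ord0 != 0.

Lemma gen_discreteE (U : 'M[C]_(K.+1 * N.+1)) n f rho :
  gen_discrete X P U n f rho = n%:R * \sum_i
    (f (toE ((\tr (sandwich X P (block X U ^~ ord0) i rho))^-1 *:
               sandwich X P (block X U ^~ ord0) i rho)) - f (toE rho))
    * complex.Re (\tr (sandwich X P (block X U ^~ ord0) i rho)).
Proof.
congr (_ * _); apply: eq_bigr => i _.
by rewrite /postmeas (prob_trace hX) (ptrace_measure hX hP).
Qed.

Lemma jump_termE f i rho : C2c f -> positive_op rho ->
  complex.Re (intensity X P L i rho) *
    (f (toE rho + toE (jump X P L i rho)) - f (toE rho)
     - D1 f (toE rho) (toE (jump X P L i rho))) =
  jump_term f (jump_num X P L i rho) rho.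
Proof.
move=> fC pos; have Jpos := jump_num_ge0 X hP L i pos.
have v0 : 0 <= intensity X P L i rho := positive_op_tr Jpos.
have -> : toE rho + toE (jump X P L i rho) =
    toE ((intensity X P L i rho)^-1 *: jump_num X P L i rho).
  by rewrite -toED /jump addrC subrK.
rewrite /jump_term -/(intensity X P L i rho) /jump.
rewrite mulrBr mulrC; congr (_ - _).
rewrite -(linear_scale _ _ (D1_linear f _)) -toEZ (ge0_Re v0) scalerBr scalerA.
(* When the intensity is 0, positivity makes the numerator 0, so the default value of the inverse is
   harmless. *)
have [J0|J0] := eqVneq (intensity X P L i rho) 0; last by rewrite mulfV // scale1r.
by rewrite J0 mul0r (positive_op_tr_eq0 Jpos J0) !scale0r.
Qed.

Lemma gen_jump_diffusionE f rho : C2c f -> positive_op rho ->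
  gen_jump_diffusion X P L f rho = limit_gen X P L f rho.
Proof.
move=> fC pos; rewrite /gen_jump_diffusion /limit_gen addrC.
rewrite jump_partE // => [|i]; last by apply: positive_op_tr; exact: (jump_num_ge0 _ hP).
rewrite addrA addrAC; congr (_ + _).
(* The index 0 is excluded automatically, since p^0_00 <> 0. *)
have pI i : (i \in idxI X P) = (pcoef X P i ord0 ord0 == 0).
  by rewrite inE; case: eqP => //= ->; rewrite (negbTE hp0).
rewrite mulr_sumr [RHS](bigID (mem (idxI X P))) /=; congr (_ + _).
  apply: eq_bigr => i iI; rewrite -pI iI.
  by rewrite jump_termE.
rewrite (eq_bigl (fun i => i \notin idxI X P)) => [|i].
  by apply: eq_bigr => i iI; rewrite -pI (negbTE iI).
by rewrite !inE; case: eqP => //= _; rewrite andbT.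
Qed.

(** The other outcomes have zero row and column of index 0, so sum_i p^i_kl = delta_kl determines
    those of outcome 0. *)
Lemma pcoef00_eq1 : idxI X P = [set~ ord0]%SET ->
  pcoef X P ord0 ord0 ord0 = 1 /\ forall k, k != ord0 ->
    pcoef X P ord0 k ord0 = 0 /\ pcoef X P ord0 ord0 k = 0.
Proof.
move=> eI; have p0 i : i != ord0 -> pcoef X P i ord0 ord0 = 0.
  move=> i0; have : i \in idxI X P by rewrite eI !inE.
  by rewrite inE i0 => /eqP.
have sum0 (g : 'I_p.+1 -> C) : (forall i, i != ord0 -> g i = 0) -> g ord0 = \sum_i g i.
  by move=> g0; rewrite (bigD1 ord0) //= big1 // addr0.
split=> [|k k0].
  by rewrite (sum0 (fun i => pcoef X P i ord0 ord0)) // (sum_pcoef hX hP).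
have pk i : i != ord0 -> pcoef X P i ord0 k = 0 /\ pcoef X P i k ord0 = 0.
  by move=> i0; exact: (pcoef_eq0 hP k (p0 i i0)).
split.
  rewrite (sum0 (fun i => pcoef X P i k ord0)) => [|i /pk[]//].
  by rewrite (sum_pcoef hX hP) (negbTE k0).
rewrite (sum0 (fun i => pcoef X P i ord0 k)) => [|i /pk[]//].
by rewrite (sum_pcoef hX hP) eq_sym (negbTE k0).
Qed.

(** The pure jump case is an instance of the general formula: J is empty and h_0 = 0, because all
    p^0_k0 and p^0_0k with k <> 0 vanish. *)
Lemma gen_jumpE f rho : C2c f -> idxI X P = [set~ ord0]%SET ->
  gen_jump X P L f rho = gen_jump_diffusion X P L f rho.
Proof.
move=> fC eI; rewrite /gen_jump /gen_jump_diffusion -eI /idxJ -eI finset.setDv.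
rewrite finset.setU0 big_set1.
have -> : diff_coef X P L ord0 rho = 0.
  have D0 : diff_num X P L ord0 rho = 0.
    apply: big1 => k k0; have [_ /(_ k k0)[-> ->]] := pcoef00_eq1 eI.
    by rewrite !scale0r addr0.
  by rewrite /diff_coef D0 mxtrace0 scale0r subr0 scaler0.
have -> : toE (0 : 'M[C]_K.+1) = 0.
  by rewrite -(subrr (0 : 'M[C]_K.+1)) toED toEN subrr.
by rewrite /D2 linear0 mulr0 addr0.
Qed.

End GeneratorFormulas.

(** * The scale 1/sqrt(n) and the proof of the theorem *)

Lemma cvg_sqrt_nat_inv (R : realType) :
  (Num.sqrt n%:R)^-1 @[n --> \oo] --> (0 : R).
Proof.
apply/cvgrPdist_lt => e e0; near=> n.
have e2 : 0 < e ^- 2 by rewrite invr_gt0 exprn_gt0.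
have hn : e ^- 2 < n%:R.
  apply: (@lt_le_trans _ _ (Num.truncn (e ^- 2)).+1%:R).
    by apply: truncnS_gt.
  by rewrite ler_nat; near: n; exact: nbhs_infty_ge.
have n0 : 0 < n%:R :> R by exact: lt_trans hn.
have s0 : 0 < Num.sqrt (n%:R : R) by rewrite sqrtr_gt0.
rewrite sub0r normrN ger0_norm ?invr_ge0 ?ltW //.
rewrite invf_plt ?posrE // -ltr_sqr ?nnegrE ?invr_ge0 ?ltW // sqr_sqrtr ?ltW //.
by rewrite exprVn.
Unshelve. all: by end_near. Qed.

Theorem proposition2 (R : realType) (K N p : nat)
  (X : 'I_N.+1 -> 'cV[R[i]]_N.+1)
  (U : nat -> 'M[R[i]]_(K.+1 * N.+1))
  (L : 'I_N.+1 -> 'M[R[i]]_K.+1)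
  (A : 'M[R[i]]_N.+1) (lambda : 'I_p.+1 -> R) (P : 'I_p.+1 -> 'M[R[i]]_N.+1)
  (hX : orthonormal_basis X)
  (hU : forall n, (0 < n)%N -> U n \is unitarymx)
  (hL0 : toE (n%:R *: (block X (U n) ord0 ord0 - 1%:M)) @[n --> \oo]
           --> toE (L ord0))
  (hL : forall k : 'I_N.+1, k != ord0 ->
     toE ((Num.sqrt n%:R)%:C *: block X (U n) k ord0) @[n --> \oo]
       --> toE (L k))
  (hA : A^t* = A)
  (hP : spectral_decomposition A lambda P)
  (hp0 : pcoef X P ord0 ord0 ord0 != 0) :
  (idxI X P = [set~ ord0]%SET ->
     [/\ pcoef X P ord0 ord0 ord0 = 1,
         idxJ X P = finset.set0
       & forall f : opE R K -> R, C2c f ->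
           unif_cvg_on_states (fun n => gen_discrete X P (U n) n f)
                              (gen_jump X P L f)])
  /\
  (idxI X P <> [set~ ord0]%SET ->
     [/\ pcoef X P ord0 ord0 ord0 <> 1,
         idxJ X P <> finset.set0
       & forall f : opE R K -> R, C2c f ->
           unif_cvg_on_states (fun n => gen_discrete X P (U n) n f)
                              (gen_jump_diffusion X P L f)]).

Proof.
(* Convergence to the jump-diffusion form holds in both cases; [gen_jumpE] then rewrites the limit
   in the first one. *)
have cvgU (f : opE R K -> R) : C2c f ->
    unif_cvg_on_states (fun n => gen_discrete X P (U n) n f) (gen_jump_diffusion X P L f).
  move=> fC; apply: unif_cvg_on_statesP => F FF rho rho0 cn crho rhoS.
  pose r (t : opE R K * nat) : R := Num.sqrt t.2%:R.
  pose V (t : opE R K * nat) k := block X (U t.2) k ord0.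
  have r2 t : r t ^+ 2 = t.2%:R by rewrite sqr_sqrtr.
  have n_gt0 : \forall t \near F, (0 < t.2)%N.
    exact: (cn [set n | (0 < n)%N] (nbhs_infty_gt 0)).
  have hr : \forall t \near F, 0 < r t.
    by apply: filterS n_gt0 => t t0; rewrite sqrtr_gt0 ltr0n.
  have hrV : (r t)^-1 @[t --> F] --> (0 : R) by exact: cvg_comp cn (@cvg_sqrt_nat_inv R).
  have hV0 : cvgcm F (fun t => (r t ^+ 2)%:C *: (V t ord0 - 1%:M)) (L ord0).
    apply/cvg_toEP; under eq_fun do rewrite r2 rmorph_nat.
    exact: cvg_comp cn hL0.
  have hV k : k != ord0 -> cvgcm F (fun t => (r t)%:C *: V t k) (L k).
    by move=> k0; apply/cvg_toEP; exact: cvg_comp cn (hL k k0).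
  (* Unitarity is assumed from n = 1 on, so the probabilities add up to 1 eventually along [F]. *)
  have tot : \forall t \near F, \sum_i \tr (sandwich X P (V t) i (rho t)) = 1.
    near=> t; have [_ <-] : states (rho t) by near: t.
    rewrite -(sum_prob hX hP (rho t) (hU t.2 _)); last by near: t.
    by apply: eq_bigr => i _; rewrite (prob_trace hX).
  have h := cvg_step_sub hX hP fC hr hrV hV0 hV crho rhoS tot.
  apply: cvg_trans (h FF); apply: near_eq_cvg; near=> t.
  have [pos _] : states (rho t) by near: t.
  by rewrite (gen_discreteE hX hP) (gen_jump_diffusionE L hP hp0 fC pos) r2.
split=> eI.
  have [p1 _] := pcoef00_eq1 hX hP eI; split=> //.
    by rewrite /idxJ eI finset.setDv.
  move=> f fC; have -> : gen_jump X P L f = gen_jump_diffusion X P L f.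
    by apply/funext => rho; exact: (gen_jumpE L hX hP).
  exact: cvgU.
have JN0 : idxJ X P <> finset.set0.
  move=> J0; apply: eI; apply/eqP; rewrite finset.eqEsubset; apply/andP; split.
    by apply/fintype.subsetP => i; rewrite !inE => /andP[].
  by rewrite -finset.setD_eq0; apply/eqP.
(* If p^0_00 = 1, the other p^i_00 are nonnegative with sum 0, so they all vanish and J is empty. *)
split=> // p1; apply: JN0; apply/finset.setP => i; rewrite !inE.
case: eqP => [->|/eqP i0]; rewrite ?andbF //= andbT.
apply/negPn.
have := sum_pcoef hX hP ord0 ord0; rewrite eqxx (bigD1 ord0) //= p1 => /eqP.
rewrite -subr_eq0 addrAC subrr add0r psumr_eq0 => [/allP/(_ i)|j _]; last exact: pcoef_ge0 hP _ _.
by rewrite mem_index_enum i0 => /(_ isT).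
Unshelve. all: by end_near. Qed.
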